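(* Let $P(z,w)=Q(z)w-R(z)$ with $Q,R\in\mathbb C[z]$, $\gcd(Q,R)=1$, and let $f=R/Q$ be a positive germ, $f(z)=a_0/z+O(z^{-2})$ at infinity with $a_0>0$. Let $K\subset\mathbb C$ be compact and convex with $\mathcal M_f(K)\ne\varnothing$. Then $\delta_P(f;K)=0$ if and only if all poles of $f$ are simple, lie in $K$, and have positive residues. In that case the unique $\mu\in\mathcal M_f(K)$ with $\mathfrak D_{P,K}(\mu)=0$ is $\mu=\sum_kc_k\delta_{z_k}$, where $z_k$ are the poles of $f$ and $c_k=\operatorname{res}_{z_k}f>0$.
   Context: $dA$ is planar Lebesgue measure. For a finite compactly supported complex Borel measure $\mu$ on $\mathbb C$, its Cauchy transform is $\mathcal C_\mu(z)=\int_{\mathbb C}\frac{d\mu(\zeta)}{z-\zeta}$ (defined for almost every $z$, in $L^1_{\mathrm{loc}}(\mathbb C)$). $\mathcal M_f(K)$ is the set of positive measures supported in $K$ whose Cauchy transform has germ $f$ at infinity. Here $\deg_wP=1$, so $\mathfrak D_{P,K}(\mu)=\int_K|Q(z)\mathcal C_\mu(z)-R(z)|\,dA(z)$, and $\delta_P(f;K)=\min_{\mu\in\mathcal M_f(K)}\mathfrak D_{P,K}(\mu)$ (attained when $\mathcal M_f(K)\ne\varnothing$). $\delta_{z_k}$ is the unit point mass at $z_k$. *)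

(* Defs.v *)
From HB Require Import structures.
From mathcomp Require Import all_boot all_order all_algebra.
From mathcomp Require Export complex.
From mathcomp Require Import all_classical all_reals all_analysis.

Set Implicit Arguments.
Unset Strict Implicit.
Unset Printing Implicit Defensive.

Import Order.TTheory GRing.Theory Num.Theory.
Import numFieldNormedType.Exports.

Local Open Scope classical_set_scope.
Local Open Scope ring_scope.

(* The complex plane appears in two guises: [R[i]] for arithmetic, and
   [R * R], with its product topology, Borel sigma-algebra and real vector
   space structure, for sets, measures and convexity. *)
Definition toC (R : realType) (p : R * R) : R[i] := Complex p.1 p.2.

Definition ofC (R : realType) (z : R[i]) : R * R :=
  (complex.Re z, complex.Im z).

(* Real-valued modulus; [`|z|] itself is an element of [R[i]]. *)
Definition cmod (R : realType) (z : R[i]) : R := ComplexField.Normc.normc z.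

Definition area (R : realType) : set (R * R)%type -> \bar R :=
  (lebesgue_measure \x lebesgue_measure)%E.

(* The integral of a complex function is taken componentwise.  Where the
   integrand is not integrable, which happens only for z in a set of area
   zero, the value is irrelevant. *)
Definition cauchy_transform (R : realType)
    (mu : {finite_measure set (R * R)%type -> \bar R}) (z : R[i]) : R[i] :=
  Complex (\int[mu]_(p in [set: R * R]) complex.Re ((z - toC p)^-1))%R
          (\int[mu]_(p in [set: R * R]) complex.Im ((z - toC p)^-1))%R.

Definition same_germ_at_infinity (R : realType) (f g : R[i] -> R[i]) : Prop :=
  exists r : R, forall z : R[i], r < cmod z -> f z = g z.

(* For compact (hence closed) K, [mu (~` K) = 0] says that the support of mu
   is contained in K. *)
Definition representing_measures (R : realType) (f : R[i] -> R[i])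
    (K : set (R * R)%type) : set {finite_measure set (R * R)%type -> \bar R} :=
  [set mu : {finite_measure set (R * R)%type -> \bar R} |
     mu (~` K) = 0%E /\ same_germ_at_infinity (cauchy_transform mu) f].

(* f(z) = a0 / z + O(z^-2) at infinity, with a0 > 0. *)
Definition positive_germ (R : realType) (f : R[i] -> R[i]) : Prop :=
  exists a0 : R, 0 < a0 /\
    exists M r : R, forall z : R[i], r < cmod z ->
      cmod (f z - (a0%:C)%C / z) <= M / cmod z ^+ 2.

Definition ratfun (R : realType) (N Q : {poly R[i]}) (z : R[i]) : R[i] :=
  N.[z] / Q.[z].

(* D_{P,K}(mu) for P(z, w) = Q(z) w - N(z). *)
Definition deviation (R : realType) (Q N : {poly R[i]}) (K : set (R * R)%type)
    (mu : {finite_measure set (R * R)%type -> \bar R}) : \bar R :=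
  (\int[@area R]_(p in K)
     (cmod (Q.[toC p] * cauchy_transform mu (toC p) - N.[toC p]))%:E)%E.

(* The infimum, which is the minimum whenever the latter exists. *)
Definition min_deviation (R : realType) (Q N : {poly R[i]})
    (f : R[i] -> R[i]) (K : set (R * R)%type) : \bar R :=
  ereal_inf (deviation Q N K @` representing_measures f K).

(* [(R[i])^o] carries the usual topology of the complex field. *)
Definition pole_of_order (R : realType) (f : R[i] -> R[i]) (z0 : R[i])
    (m : nat) : Prop :=
  (0 < m)%N /\
  exists c : R[i], c != 0 /\
    (z - z0) ^+ m * f z @[z --> (z0 : (R[i])^o)^'] --> (c : (R[i])^o).

Definition poles (R : realType) (f : R[i] -> R[i]) : set R[i] :=
  [set z0 | exists m, pole_of_order f z0 m].

(* c is the coefficient of (z - z0)^-1 in the principal part of f at z0: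
   subtracting that principal part leaves a removable singularity. *)
Definition is_residue (R : realType) (f : R[i] -> R[i]) (z0 c : R[i]) : Prop :=
  exists (n : nat) (b : 'I_n.+1 -> R[i]), b ord0 = c /\
    exists l : R[i],
      f z - \sum_(j < n.+1) b j / (z - z0) ^+ j.+1
        @[z --> (z0 : (R[i])^o)^'] --> (l : (R[i])^o).

Definition residue (R : realType) (f : R[i] -> R[i]) (z0 : R[i]) : R[i] :=
  get (is_residue f z0 : set (R[i])^o).

(* sum over the (finitely many) poles of f of residue * point mass *)
Definition residue_measure (R : realType) (f : R[i] -> R[i])
    (A : set (R * R)%type) : \bar R :=
  (\sum_(z \in poles f) (complex.Re (residue f z))%:E * \d_(ofC z) A)%E.

(* Main.v *)
Require Import Defs.
From HB Require Import structures.
From mathcomp Require Import all_boot all_order all_algebra.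
From mathcomp Require Import complex.
From mathcomp Require Import all_classical all_reals all_analysis.
From mathcomp Require Import measurable_realfun ring lra.

Set Implicit Arguments.
Unset Strict Implicit.
Unset Printing Implicit Defensive.

Import Order.TTheory GRing.Theory Num.Theory.
Import numFieldNormedType.Exports.

Local Open Scope classical_set_scope.
Local Open Scope ring_scope.

(** Let mu represent f = N / Q on K.  Then Q C_mu - N is the Cauchy transform of
    the measure Q mu.  It vanishes off K, since a point outside the convex set K
    is separated from it by a disc centred at some c, and multiplying Q by
    (X - c)^n multiplies the transform by (z - c)^n.  So the deviation of mu
    is the L^1 norm of the transform T of Q mu over the whole plane.  Pairing
    g T, for a polynomial g, with a function psi of Im z over large boxes gives,
    by Fubini, |int Psi(Im p) g(p) Q(p) dmu(p)| <= S * deviation for any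
    primitive Psi of psi, with S independent of mu.  Since
    conj p = p - 2 i Im p, the function conj Q is a combination of such factors,
    and therefore int |Q|^2 dmu <= S * deviation.

    If the infimum of the deviations is 0, then a function phi with
    |phi|^2 <= C |Q| on K has arbitrarily small integrals.  When
    Q = (X - z) Q', the integral of Q' is N(z) for every mu.  If z were a
    multiple root, phi = Q' would give N(z) = 0; so z is simple, and
    phi = l - |l|^2 with l = Q' / Q'(z) shows that the residue
    N(z) / Q'(z) = int l is nonnegative.  A measure of deviation 0 is carried by
    the roots of Q, and int Q' = N(z) determines its atoms; conversely the
    partial fractions of f show that the atomic measure represents f. *)

(** A zero infimum supplies only measures of small deviation, not one of deviation zero. Every
    estimate therefore has one constant for all representing measures, and it is applied to
    integrals whose value [f] already fixes: the mass [a0], and [int Q' dmu = N(z)]. A bound for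
    such an integral that tends to 0 with the deviation constrains the number itself, so no limit
    measure is ever constructed. The test functions depend on [Im z] because [1 / (z - p)]
    integrates over a whole horizontal line, as a principal value, to [- i pi sgn (Im z - Im p)].
    Weighting the lines by [psi] and integrating over heights in [[-L, L]] gives [- i pi (Psi L +
    Psi (- L) - 2 Psi (Im p))]. The terms free of [p] drop out: since [Q C_mu = N] near infinity,
    every [int g Q dmu] is 0. The square in [|phi|^2 <= C |Q|] is what a multiple root calls for: if
    [Q = (X - z) Q'] and [Q' = (X - z) Q1], then [Q'^2 = Q1 Q], whereas [Q' / Q] is unbounded near
    [z]. *)

Section modulus.
Context {R : realType}.
Implicit Types z w : R[i].

Lemma cmod_ge0 z : 0 <= cmod z.
Proof. by case: z => a b; exact: sqrtr_ge0. Qed.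

Lemma cmod0 : cmod (0 : R[i]) = 0.
Proof. exact: ComplexField.Normc.normc0. Qed.

Lemma cmod1 : cmod (1 : R[i]) = 1.
Proof. exact: ComplexField.Normc.normc1. Qed.

Lemma cmod_eq0 z : (cmod z == 0) = (z == 0).
Proof.
by apply/eqP/eqP => [/ComplexField.Normc.eq0_normc //|->]; exact: cmod0.
Qed.

Lemma cmod_gt0 z : (0 < cmod z) = (z != 0).
Proof. by rewrite lt_neqAle cmod_ge0 andbT eq_sym cmod_eq0. Qed.

Lemma cmodM z w : cmod (z * w) = cmod z * cmod w.
Proof. exact: ComplexField.Normc.normcM. Qed.

Lemma cmodV z : cmod z^-1 = (cmod z)^-1.
Proof. exact: ComplexField.Normc.normcV. Qed.

Lemma cmodX z n : cmod (z ^+ n) = cmod z ^+ n.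
Proof. by elim: n => [|n IH]; rewrite ?cmod1 // !exprS cmodM IH. Qed.

Lemma cmodD_le z w : cmod (z + w) <= cmod z + cmod w.
Proof. exact: le_normcD. Qed.

Lemma cmodN z : cmod (- z) = cmod z.
Proof. exact: normcN. Qed.

Lemma cmodB_le z w : cmod (z - w) <= cmod z + cmod w.
Proof. by rewrite (le_trans (cmodD_le _ _))// cmodN. Qed.

Lemma cmod_distC z w : cmod (z - w) = cmod (w - z).
Proof. by rewrite -cmodN opprB. Qed.

Lemma cmod_ge_sub z w : cmod z - cmod w <= cmod (z - w).
Proof.
by rewrite lerBlDr -[X in cmod X <= _](subrK w) cmodD_le.
Qed.

Lemma cmod_sqr z : cmod z ^+ 2 = complex.Re z ^+ 2 + complex.Im z ^+ 2.
Proof. by case: z => a b; rewrite /cmod /= sqr_sqrtr// addr_ge0// sqr_ge0. Qed.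

Lemma cmod_real (a : R) : cmod (a%:C)%C = `|a|.
Proof. by rewrite /cmod /= expr0n addr0 sqrtr_sqr. Qed.

Lemma cmod_conjc z : cmod (conjc z) = cmod z.
Proof. by case: z => a b; rewrite /cmod /= sqrrN. Qed.

Lemma mul_conjc z : conjc z * z = ((cmod z ^+ 2)%:C)%C.
Proof.
rewrite cmod_sqr; case: z => a b /=; apply/eqP; rewrite eq_complex /=.
by apply/andP; split; apply/eqP; ring.
Qed.

Lemma normr_Re_le z : `|complex.Re z| <= cmod z.
Proof.
rewrite -(ler_pXn2r (n := 2)) ?nnegrE ?cmod_ge0// cmod_sqr.
by rewrite real_normK ?num_real// lerDl sqr_ge0.
Qed.

Lemma normr_Im_le z : `|complex.Im z| <= cmod z.
Proof.
rewrite -(ler_pXn2r (n := 2)) ?nnegrE ?cmod_ge0// cmod_sqr.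
by rewrite real_normK ?num_real// lerDr sqr_ge0.
Qed.

Lemma cmod_le_ReIm z : cmod z <= `|complex.Re z| + `|complex.Im z|.
Proof.
have h : 0 <= `|complex.Re z| + `|complex.Im z| by rewrite addr_ge0.
rewrite -(ler_pXn2r (n := 2)) ?nnegrE ?cmod_ge0// cmod_sqr sqrrD.
by rewrite !real_normK ?num_real// lerD2r lerDl mulrn_wge0// mulr_ge0.
Qed.

Lemma toCK : cancel (@toC R) (@ofC R).
Proof. by case. Qed.

Lemma ofCK : cancel (@ofC R) (@toC R).
Proof. by case. Qed.

End modulus.

(** * Measurability and integration of complex functions by components *)

Section complex_integral.
Context d (T : measurableType d) (R : realType).
Implicit Types (F G : T -> R[i]) (D : set T).

Definition cmeas F := measurable_fun setT (@complex.Re R \o F) /\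
  measurable_fun setT (@complex.Im R \o F).

Lemma cmeas_cst c : cmeas (fun=> c).
Proof. by split; exact: measurable_cst. Qed.

Lemma cmeasD F G : cmeas F -> cmeas G -> cmeas (fun x => F x + G x).
Proof.
move=> [F1 F2] [G1 G2]; split.
  rewrite [X in measurable_fun _ X](_ : _ =
    (@complex.Re R \o F) \+ (@complex.Re R \o G)); first exact: measurable_funD.
  by apply/funext => x /=; case: (F x) (G x) => [? ?] [].
rewrite [X in measurable_fun _ X](_ : _ =
  (@complex.Im R \o F) \+ (@complex.Im R \o G)); first exact: measurable_funD.
by apply/funext => x /=; case: (F x) (G x) => [? ?] [].
Qed.

Lemma cmeasM F G : cmeas F -> cmeas G -> cmeas (fun x => F x * G x).
Proof.
move=> [F1 F2] [G1 G2]; split.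
  rewrite [X in measurable_fun _ X](_ : _ =
    ((@complex.Re R \o F) \* (@complex.Re R \o G)) \-
    ((@complex.Im R \o F) \* (@complex.Im R \o G))).
    by apply: measurable_funB; exact: measurable_funM.
  by apply/funext => x /=; case: (F x) (G x) => [? ?] [].
rewrite [X in measurable_fun _ X](_ : _ =
  ((@complex.Re R \o F) \* (@complex.Im R \o G)) \+
  ((@complex.Im R \o F) \* (@complex.Re R \o G))).
  by apply: measurable_funD; exact: measurable_funM.
by apply/funext => x /=; case: (F x) (G x) => [? ?] [? ?] /=; ring.
Qed.

Lemma cmeasN F : cmeas F -> cmeas (fun x => - F x).
Proof.
move=> mF; rewrite (_ : (fun x => - F x) = fun x => (-1) * F x).
  by apply: cmeasM => //; exact: cmeas_cst.
by apply/funext => x; rewrite mulN1r.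
Qed.

(** Inversion agrees with the power of exponent -1 on nonnegative reals, 0 included, so the zeros of
    [f] need no separate treatment. *)
Lemma measurable_fun_inv (f : T -> R) : measurable_fun setT f ->
  (forall x, 0 <= f x) -> measurable_fun setT (fun x => (f x)^-1).
Proof.
move=> mf f0; rewrite (_ : (fun x => _) = (fun y => y `^ (-1)) \o f).
  by apply: measurableT_comp => //; exact: measurable_powR.
by apply/funext => x /=; rewrite powR_inv1.
Qed.

Lemma cmeasV F : cmeas F -> cmeas (fun x => (F x)^-1).
Proof.
move=> [F1 F2].
pose n := fun x => (complex.Re (F x) ^+ 2 + complex.Im (F x) ^+ 2)^-1.
have mn : measurable_fun setT n.
  apply: measurable_fun_inv; last by move=> x; rewrite addr_ge0// sqr_ge0.
  by apply: measurable_funD; exact: measurable_funX.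
split.
  rewrite [X in measurable_fun _ X](_ : _ = (@complex.Re R \o F) \* n).
    exact: measurable_funM.
  by apply/funext => x /=; rewrite /n; case: (F x).
rewrite [X in measurable_fun _ X](_ : _ = (\- (@complex.Im R \o F)) \* n).
  by apply: measurable_funM => //; exact: measurable_funN.
by apply/funext => x /=; rewrite /n; case: (F x) => ? ? /=; rewrite mulNr.
Qed.

Lemma measurable_cmod F : cmeas F -> measurable_fun setT (@cmod R \o F).
Proof.
move=> [F1 F2]; rewrite (_ : _ \o _ = (fun y => y `^ 2^-1) \o
    ((fun x => complex.Re (F x) ^+ 2 + complex.Im (F x) ^+ 2))).
  apply: measurableT_comp; first exact: measurable_powR.
  by apply: measurable_funD; exact: measurable_funX.
apply/funext => x /=; rewrite powR12_sqrt ?addr_ge0 ?sqr_ge0//.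
by case: (F x).
Qed.

Lemma cmeas_horner (p : {poly R[i]}) F : cmeas F -> cmeas (fun x => p.[F x]).
Proof.
move=> mF; elim/poly_ind: p => [|p c IH].
  by under eq_fun do rewrite horner0; exact: cmeas_cst.
under eq_fun do rewrite hornerMXaddC.
by apply: cmeasD; [exact: cmeasM|exact: cmeas_cst].
Qed.

Lemma cmeas_conjc F : cmeas F -> cmeas (fun x => conjc (F x)).
Proof.
move=> [F1 F2]; split.
  rewrite [X in measurable_fun _ X](_ : _ = @complex.Re R \o F)//.
  by apply/funext => x /=; case: (F x).
rewrite [X in measurable_fun _ X](_ : _ = \- (@complex.Im R \o F)).
  exact: measurable_funN.
by apply/funext => x /=; case: (F x).
Qed.

Lemma cmeas_real (f : T -> R) : measurable_fun setT f ->
  cmeas (fun x => ((f x)%:C)%C).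
Proof. by move=> mf; split => //=; exact: measurable_cst. Qed.

Variable m : {measure set T -> \bar R}.

Definition cintegrable F := m.-integrable setT (EFin \o (@complex.Re R \o F)) /\
  m.-integrable setT (EFin \o (@complex.Im R \o F)).

(** The componentwise form matches [cauchy_transform], which thereby becomes an instance of
    [cint]. *)
Definition cint F : R[i] :=
  Complex (\int[m]_(x in setT) complex.Re (F x))%R
          (\int[m]_(x in setT) complex.Im (F x))%R.

Lemma cintegrable_cmeas F : cintegrable F -> cmeas F.
Proof.
by move=> [/measurable_int/measurable_EFinP ? /measurable_int/measurable_EFinP].
Qed.

Lemma cintegrable_le F (g : T -> R) : cmeas F ->
  m.-integrable setT (EFin \o g) -> (forall x, cmod (F x) <= g x) ->
  cintegrable F.
Proof.
move=> [F1 F2] ig Fg; split; apply: le_integrable ig => //=;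
  try exact/measurable_EFinP; move=> x _; rewrite lee_fin;
  apply: (le_trans _ (ler_norm _)); apply: le_trans (Fg x).
- exact: normr_Re_le.
- exact: normr_Im_le.
Qed.

Lemma cintegrable_cmod F : cintegrable F ->
  m.-integrable setT (EFin \o (@cmod R \o F)).
Proof.
move=> iF; have mF := cintegrable_cmeas iF.
have [/integrable_norm i1 /integrable_norm i2] := iF.
apply: (le_integrable _ _ _ (integrableD _ i1 i2)) => //=.
  exact/measurable_EFinP/measurable_cmod.
move=> x _; rewrite lee_fin ger0_norm ?cmod_ge0//.
by rewrite (le_trans (cmod_le_ReIm _))// ler_norm.
Qed.

Lemma cintegrableP F : cmeas F -> cintegrable F <->
  m.-integrable setT (EFin \o (@cmod R \o F)).
Proof.
move=> mF; split; first exact: cintegrable_cmod.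
by move=> h; apply: cintegrable_le h _.
Qed.

Lemma cintegrableD F G : cintegrable F -> cintegrable G ->
  cintegrable (fun x => F x + G x).
Proof.
move=> iF iG.
have := integrableD measurableT (cintegrable_cmod iF) (cintegrable_cmod iG).
move=> h; apply: (cintegrable_le _ h).
  by apply: cmeasD; exact: cintegrable_cmeas.
by move=> x; exact: cmodD_le.
Qed.

Lemma cintegrableMl F G (C : R) : cmeas G -> cintegrable F ->
  (forall x, cmod (G x) <= C) -> cintegrable (fun x => G x * F x).
Proof.
move=> mG iF GC.
have := integrableZl measurableT C (cintegrable_cmod iF).
move=> h; apply: (cintegrable_le _ h).
  by apply: cmeasM => //; exact: cintegrable_cmeas.
by move=> x; rewrite cmodM ler_wpM2r// cmod_ge0.
Qed.

Lemma cintegrableZ F c : cintegrable F -> cintegrable (fun x => c * F x).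
Proof.
by move=> iF; apply: (cintegrableMl (cmeas_cst c) iF (C := cmod c)).
Qed.

Lemma eq_cint F G : F =1 G -> cint F = cint G.
Proof. by move=> /funext ->. Qed.

Lemma cintD F G : cintegrable F -> cintegrable G ->
  cint (fun x => F x + G x) = cint F + cint G.
Proof.
move=> [F1 F2] [G1 G2]; apply/eqP; rewrite eq_complex /=; apply/andP; split.
  rewrite -RintegralD//; apply/eqP/eq_Rintegral => x _.
  by case: (F x) (G x) => [? ?] [].
rewrite -RintegralD//; apply/eqP/eq_Rintegral => x _.
by case: (F x) (G x) => [? ?] [].
Qed.

Lemma cintZ F c : cintegrable F -> cint (fun x => c * F x) = c * cint F.
Proof.
move=> [F1 F2]; apply/eqP; rewrite eq_complex; case: c => a b /=.
have Za k (f : T -> R) : m.-integrable setT (EFin \o f) ->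
    m.-integrable setT (EFin \o (fun x => k * f x)).
  by move=> h; exact: (integrableZl measurableT k h).
apply/andP; split; apply/eqP.
  rewrite -!RintegralZl// -RintegralB//; try exact: Za.
  by apply: eq_Rintegral => x _; case: (F x).
rewrite -!RintegralZl// -RintegralD//; try exact: Za.
by apply: eq_Rintegral => x _; case: (F x).
Qed.

Lemma cintN F : cintegrable F -> cint (fun x => - F x) = - cint F.
Proof.
by move=> iF; rewrite -mulN1r -cintZ//; apply: eq_cint => x; rewrite mulN1r.
Qed.

Lemma cintegrableN F : cintegrable F -> cintegrable (fun x => - F x).
Proof.
move=> /(cintegrableZ (-1)).
by rewrite (_ : (fun x => -1 * F x) = fun x => - F x)//;
  apply/funext => x; rewrite mulN1r.
Qed.

Lemma cintB F G : cintegrable F -> cintegrable G ->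
  cint (fun x => F x - G x) = cint F - cint G.
Proof.
by move=> iF iG; rewrite (cintD iF (cintegrableN iG)) cintN.
Qed.

Lemma cintegrableB F G : cintegrable F -> cintegrable G ->
  cintegrable (fun x => F x - G x).
Proof. by move=> iF iG; exact: (cintegrableD iF (cintegrableN iG)). Qed.

Lemma cint_real (f : T -> R) :
  cint (fun x => ((f x)%:C)%C) = ((\int[m]_(x in setT) f x)%R%:C)%C.
Proof.
by congr Complex; rewrite /= /Rintegral integral0.
Qed.

(* Rotating the integral onto the positive real axis costs nothing. *)
Lemma cmod_cint_le F : cintegrable F ->
  cmod (cint F) <= (\int[m]_(x in setT) cmod (F x))%R.
Proof.
move=> iF; set c := cint F.
have [->|c0] := eqVneq c 0.
  by rewrite cmod0; apply: Rintegral_ge0 => x _; exact: cmod_ge0.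
have cp : 0 < cmod c by rewrite cmod_gt0.
rewrite -(ler_pM2l cp) -expr2.
have -> : cmod c ^+ 2 = complex.Re (cint (fun x => conjc c * F x)).
  by rewrite cintZ// -/c mul_conjc.
have iZ := cintegrableZ (conjc c) iF.
rewrite -RintegralZl//; last exact: cintegrable_cmod.
apply: le_Rintegral => //; first by case: iZ.
  exact: (integrableZl measurableT (cmod c) (cintegrable_cmod iF)).
move=> x _; rewrite (le_trans (ler_norm _))// (le_trans (normr_Re_le _))//.
by rewrite cmodM cmod_conjc.
Qed.

Lemma ae_eq_Rintegral (f g : T -> R) : measurable_fun setT f ->
  measurable_fun setT g -> {ae m, forall x, f x = g x} ->
  (\int[m]_(x in setT) f x = \int[m]_(x in setT) g x)%R.
Proof.
move=> mf mg fg; congr fine; apply: ae_eq_integral => //.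
- exact/measurable_EFinP.
- exact/measurable_EFinP.
- by apply: filterS fg => x -> _.
Qed.

Lemma ae_eq_cint F G : cmeas F -> cmeas G -> {ae m, forall x, F x = G x} ->
  cint F = cint G.
Proof.
move=> [F1 F2] [G1 G2] FG; congr Complex.
  by apply: ae_eq_Rintegral => //; apply: filterS FG => x /= ->.
by apply: ae_eq_Rintegral => //; apply: filterS FG => x /= ->.
Qed.

Lemma ae_eq_cintegrable F G : cmeas G -> {ae m, forall x, F x = G x} ->
  cintegrable F -> cintegrable G.
Proof.
move=> mG FG iF; have mF := cintegrable_cmeas iF; apply/(cintegrableP mG).
move/(cintegrableP mF): iF => /integrableP[_ h]; apply/integrableP; split.
  exact/measurable_EFinP/measurable_cmod.
apply: le_lt_trans h; rewrite le_eqVlt; apply/predU1P; left.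
apply: ae_eq_integral => //.
- by do 2 apply: measurableT_comp => //; exact: measurable_cmod.
- by do 2 apply: measurableT_comp => //; exact: measurable_cmod.
- by apply: filterS FG => x /= ->.
Qed.

End complex_integral.

(** * Fubini's theorem for real and complex integrals *)

Section fubini.
Context d1 d2 (T1 : measurableType d1) (T2 : measurableType d2) (R : realType).
Variables (m1 : {sigma_finite_measure set T1 -> \bar R})
  (m2 : {sigma_finite_measure set T2 -> \bar R}).

Section real.
Variable f : T1 * T2 -> R.
Hypothesis fi : (m1 \x m2)%E.-integrable setT (EFin \o f).

Let F1 x := (\int[m2]_y (f (x, y))%:E)%E.
Let F2 y := (\int[m1]_x (f (x, y))%:E)%E.

Let F1i : m1.-integrable setT F1.
Proof. exact: (integrable_fubini_F fi). Qed.

Let F2i : m2.-integrable setT F2.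
Proof.
apply/integrableP; split; first exact: (measurable_fubini_G fi).
have mf := measurable_int _ fi.
have := (integrable21ltyP m1 m2 mf).1 fi.
apply: le_lt_trans.
apply: ge0_le_integral => //=.
- by apply: measurableT_comp => //; exact: (measurable_fubini_G fi).
- apply: (measurable_fun_fubini_tonelli_G (abse \o (EFin \o f))) => //=.
  exact: measurableT_comp.
- move=> y _; apply: le_abse_integral => //.
  exact: (measurableT_comp mf (measurable_pair2 y)).
Qed.

(** The real-valued inner integral is [fine] of the extended one; [fine] sends infinities to 0, so
    it never increases the absolute value. *)
Lemma integrable_Rintegral1 :
  m1.-integrable setT (EFin \o (fun x => \int[m2]_(y in setT) f (x, y))%R).
Proof.
apply: (le_integrable _ _ _ F1i) => //=.
  apply/measurable_EFinP; apply: measurableT_comp => //.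
  exact: (measurable_int _ F1i).
move=> x _; rewrite /Rintegral -/(F1 x).
by case: (F1 x) => [r||] //=; rewrite normr0 ?leey // leey.
Qed.

Lemma integrable_Rintegral2 :
  m2.-integrable setT (EFin \o (fun y => \int[m1]_(x in setT) f (x, y))%R).
Proof.
apply: (le_integrable _ _ _ F2i) => //=.
  apply/measurable_EFinP; apply: measurableT_comp => //.
  exact: (measurable_int _ F2i).
move=> x _; rewrite /Rintegral -/(F2 x).
by case: (F2 x) => [r||] //=; rewrite normr0 ?leey // leey.
Qed.

(** The extended inner integral is finite almost everywhere, so applying [fine] to it changes
    nothing under the outer integral. *)
Lemma Rintegral_prod1 :
  (\int[m1]_(x in setT) \int[m2]_(y in setT) f (x, y) =
   Rintegral (m1 \x m2)%E setT f)%R.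
Proof.
congr fine; rewrite -(integral12_prod_meas1 fi).
apply: ae_eq_integral => //.
- exact: (measurable_int _ integrable_Rintegral1).
- exact: (measurable_int _ F1i).
have := integrable_ae measurableT F1i; apply: filterS => x h _.
by rewrite /= /Rintegral fineK//; exact: h.
Qed.

Lemma Rintegral_prod2 :
  (\int[m2]_(y in setT) \int[m1]_(x in setT) f (x, y) =
   Rintegral (m1 \x m2)%E setT f)%R.
Proof.
congr fine; rewrite -(integral21_prod_meas1 fi).
apply: ae_eq_integral => //.
- exact: (measurable_int _ integrable_Rintegral2).
- exact: (measurable_int _ F2i).
have := integrable_ae measurableT F2i; apply: filterS => x h _.
by rewrite /= /Rintegral fineK//; exact: h.
Qed.

End real.

Variable F : T1 * T2 -> R[i].
Hypothesis Fi : cintegrable (m1 \x m2)%E F.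

Lemma cintegrable_cint1 : cintegrable m1 (fun x => cint m2 (fun y => F (x, y))).
Proof.
case: Fi => r i; split.
  exact: (integrable_Rintegral1 r).
exact: (integrable_Rintegral1 i).
Qed.

Lemma cintegrable_cint2 : cintegrable m2 (fun y => cint m1 (fun x => F (x, y))).
Proof.
case: Fi => r i; split.
  exact: (integrable_Rintegral2 r).
exact: (integrable_Rintegral2 i).
Qed.

Lemma ae_cintegrable1 : {ae m1, forall x, cintegrable m2 (fun y => F (x, y))}.
Proof.
case: Fi => /ae_integrable1 r /ae_integrable1 i.
by apply: filterS2 r i.
Qed.

Lemma cint_prod1 : cint m1 (fun x => cint m2 (fun y => F (x, y))) =
  cint (m1 \x m2)%E F.
Proof.
case: Fi => r i; congr Complex.
  by rewrite -(Rintegral_prod1 r).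
by rewrite -(Rintegral_prod1 i).
Qed.

Lemma cint_prod2 : cint m2 (fun y => cint m1 (fun x => F (x, y))) =
  cint (m1 \x m2)%E F.
Proof.
case: Fi => r i; congr Complex.
  by rewrite -(Rintegral_prod2 r).
by rewrite -(Rintegral_prod2 i).
Qed.

End fubini.

(** * Lebesgue measure on the line and area on the plane *)

Section plane.
Context {R : realType}.

Lemma cmeas_toC : cmeas (@toC R).
Proof.
by split; [exact: measurable_fst|exact: measurable_snd].
Qed.

(* [lebesgue_measure] and [area] live on the generated sigma-algebra
   [measurableTypeR R]; [leb] and the instances on [area] transport them to the
   canonical measurable structures of [R] and [R * R], which have the same
   measurable sets but are not convertible. *)
Definition leb : set R -> \bar R := @lebesgue_measure R.

Let leb0 : leb set0 = 0%E. Proof. exact: (measure0 (@lebesgue_measure R)). Qed.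

Let leb_ge0 A : (0 <= leb A)%E.
Proof. exact: (measure_ge0 (@lebesgue_measure R)). Qed.

Let leb_sigma_additive : semi_sigma_additive (leb : set R -> \bar R).
Proof.
move=> F mF tF mU.
exact: (@measure_semi_sigma_additive _ _ _ (@lebesgue_measure R) F).
Qed.

HB.instance Definition _ :=
  isMeasure.Build _ R R leb leb0 leb_ge0 leb_sigma_additive.

Lemma leb_itv (a b : R) : a <= b -> leb `[a, b] = (b - a)%:E.
Proof.
move=> ab; rewrite /leb lebesgue_measure_itv/= lte_fin.
by case: ltgtP ab => // -> _; rewrite subrr.
Qed.

Lemma leb_set1 (a : R) : leb [set a] = 0%E.
Proof. by rewrite /leb lebesgue_measure_set1. Qed.

Let leb_sigma_finite : sigma_finite setT leb.
Proof.
exists (fun n => `[- n%:R, n%:R]%classic).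
  apply/esym/seteqP; split => // x _; exists (Num.trunc `|x|).+1 => //=.
  by rewrite in_itv/= -ler_norml; exact/ltW/truncnS_gt.
by move=> n; split => //; rewrite leb_itv ?ltry// lerNl (le_trans _ (ler0n _ _))// oppr_le0.
Qed.

HB.instance Definition _ :=
  @Measure_isSigmaFinite.Build _ R R leb leb_sigma_finite.

Let measurable_id : measurable_fun setT (id : measurableTypeR R -> R).
Proof. by move=> _ Y mY; rewrite setTI. Qed.

Lemma ge0_integral_leb (D : set R) (f : R -> \bar R) : measurable D ->
  measurable_fun D f -> (forall x, D x -> 0 <= f x)%E ->
  (\int[leb]_(x in D) f x = \int[lebesgue_measure]_(x in D) f x)%E.
Proof.
move=> mD mf f0.
rewrite -[RHS](ge0_integral_pushforward measurable_id) //.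
by move=> x /set_mem; exact: f0.
Qed.

Lemma integral_leb (D : set R) (f : R -> \bar R) : measurable D ->
  measurable_fun D f ->
  (\int[leb]_(x in D) f x = \int[lebesgue_measure]_(x in D) f x)%E.
Proof.
move=> mD mf; rewrite [LHS]integralE [RHS]integralE.
by congr (_ - _)%E; apply: ge0_integral_leb => //;
  [exact: measurable_funepos|exact: measurable_funeneg].
Qed.

Let area0 : @area R set0 = 0%E.
Proof. exact: (measure0 (lebesgue_measure \x lebesgue_measure)%E). Qed.

Let area_ge0 A : (0 <= @area R A)%E.
Proof. exact: (measure_ge0 (lebesgue_measure \x lebesgue_measure)%E). Qed.

Let area_sigma_additive :
  semi_sigma_additive (@area R : set (R * R)%type -> \bar R).
Proof.
move=> F mF tF mU.
exact: (@measure_semi_sigma_additive _ _ _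
  (lebesgue_measure \x lebesgue_measure)%E F).
Qed.

HB.instance Definition _ :=
  isMeasure.Build _ _ _ (@area R) area0 area_ge0 area_sigma_additive.

Lemma areaE (A : set (R * R)) : measurable A -> @area R A = (leb \x leb)%E A.
Proof.
move=> mA; rewrite /area /product_measure1 /=.
rewrite -[RHS]/(\int[leb]_x (leb \o xsection A) x)%E ge0_integral_leb//.
exact: measurable_fun_xsection.
Qed.

Lemma area_setX (A B : set R) : measurable A -> measurable B ->
  @area R (A `*` B) = (leb A * leb B)%E.
Proof.
move=> mA mB; rewrite areaE; last exact: measurableX.
exact: product_measure1E.
Qed.

Lemma area_sigma_finite : sigma_finite setT (@area R).
Proof.
exists (fun n => `[- n%:R, n%:R]%classic `*` `[- n%:R, n%:R]%classic).
  apply/esym/seteqP; split => // -[x y] _.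
  exists (Num.trunc (Num.max `|x| `|y|)).+1 => //=.
  have := truncnS_gt (Num.max `|x| `|y|); move/ltW; rewrite ge_max => /andP[].
  by rewrite !ler_norml !in_itv.
move=> n; split; first exact: measurableX.
rewrite area_setX// leb_itv; first by rewrite -EFinM ltry.
by rewrite lerNl (le_trans _ (ler0n _ _))// oppr_le0.
Qed.

HB.instance Definition _ :=
  @Measure_isSigmaFinite.Build _ _ _ (@area R) area_sigma_finite.

Lemma integral_area (D : set (R * R)) (f : R * R -> \bar R) :
  (\int[@area R]_(x in D) f x = \int[(leb \x leb)%E]_(x in D) f x)%E.
Proof. by apply: eq_measure_integral => A mA _; exact: areaE. Qed.

(** An open set is the union of the rational boxes that it contains, and these are countably
    many. *)
Lemma open_measurable2 (U : set (R * R)) : open U -> measurable U.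
Proof.
move=> oU.
pose B (q : (rat * rat) * (rat * rat)) : set (R * R) :=
  `]ratr q.1.1, ratr q.1.2[%classic `*` `]ratr q.2.1, ratr q.2.2[%classic.
have -> : U = \bigcup_q (if `[< B q `<=` U >] then B q else set0).
  apply/seteqP; split; last by move=> p [q _]; case: asboolP => [qU /qU|].
  move=> [x y] /= Uxy.
  have [e /= e0 eU] : exists2 e : R, 0 < e & ball (x, y) e `<=` U.
    by apply/nbhs_ballP; exact: open_nbhs_nbhs.
  have [a xa] : exists a : rat, ratr a \in `]x - e, x[.
    by apply: rat_in_itvoo; rewrite ltrBlDr ltrDl.
  have [b xb] : exists a : rat, ratr a \in `]x, x + e[.
    by apply: rat_in_itvoo; rewrite ltrDl.
  have [c yc] : exists a : rat, ratr a \in `]y - e, y[.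
    by apply: rat_in_itvoo; rewrite ltrBlDr ltrDl.
  have [f yf] : exists a : rat, ratr a \in `]y, y + e[.
    by apply: rat_in_itvoo; rewrite ltrDl.
  rewrite !in_itv/= in xa xb yc yf.
  exists ((a, b), (c, f)) => //; rewrite asboolT.
    by split => /=; rewrite in_itv/=; lra.
  move=> [u v] [] /=; rewrite !in_itv/= => hu hv; apply: eU.
  by split; rewrite /ball/= ltr_distlC; lra.
apply: countable_bigcupT_measurable => // q; case: asboolP => // _.
exact: measurableX.
Qed.

Lemma compact_measurable2 (K : set (R * R)) : compact K -> measurable K.
Proof.
move=> cK; rewrite -(setCK K); apply: measurableC; apply: open_measurable2.
by apply: closed_openC; apply: compact_closed => //; exact: norm_hausdorff.
Qed.

End plane.

(** * Primitives of the Cauchy kernel along a horizontal line *)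

Section line.
Context {R : realType}.
Implicit Types (f F : R -> R) (a b c x y Y : R).

Lemma leb_integrable_continuous f a b : continuous f ->
  (@leb R).-integrable `[a, b] (EFin \o f).
Proof.
move=> cf; have mf : measurable_fun `[a, b] (EFin \o f).
  by apply/measurable_EFinP; apply: measurable_funTS;
    exact: continuous_measurable_fun.
apply/integrableP; split => //.
rewrite integral_leb//; last by apply: measurableT_comp.
have : lebesgue_measure.-integrable `[a, b] (EFin \o f).
  apply: continuous_compact_integrable; first exact: segment_compact.
  exact: continuous_subspaceT.
by move/integrableP => [].
Qed.

Lemma Rintegral_FTC f F a b : a <= b -> continuous f ->
  (forall x, is_derive x 1 F (f x)) ->
  (\int[@leb R]_(x in `[a, b]) f x)%R = F b - F a.
Proof.
move=> ab cf dF.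
have cF : continuous F.
  move=> x; apply: differentiable_continuous; apply/derivable1_diffP.
  by have [] := dF x.
have mf : measurable_fun `[a, b] (EFin \o f).
  by apply/measurable_EFinP; apply: measurable_funTS;
    exact: continuous_measurable_fun.
rewrite /Rintegral integral_leb//; move: ab; rewrite le_eqVlt => /predU1P[->|ab].
  by rewrite set_itv1 integral_set1 subrr.
rewrite (@continuous_FTC2 _ f F)//.
- exact: continuous_subspaceT.
- split => [x _||]; first by have [] := dF x.
    exact: cvg_at_right_filter (cF a).
  exact: cvg_at_left_filter (cF b).
- by move=> x _; rewrite derive1E; apply: derive_val.
Qed.

Lemma sum_sqr_gt0 x Y : Y != 0 -> 0 < x ^+ 2 + Y ^+ 2.
Proof. by move=> Y0; rewrite ltr_wpDl ?sqr_ge0// exprn_even_gt0. Qed.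

Lemma continuous_quot f c Y : Y != 0 -> continuous f ->
  continuous (fun x => f x / ((x - c) ^+ 2 + Y ^+ 2)).
Proof.
move=> Y0 cf x; apply: cvgM; first exact: cf.
apply: cvgV; first by rewrite gt_eqF// sum_sqr_gt0.
apply: cvgD; last exact: cvg_cst.
have h : y - c @[y --> x] --> x - c by apply: cvgB; [exact: cvg_id|exact: cvg_cst].
exact: (cvgM h h).
Qed.

(** This integrand and that of [Rintegral_ln] are, up to a sign, the imaginary and real parts of
    [1 / (x - c + i Y)]. *)
Lemma Rintegral_atan a b c Y : a <= b -> Y != 0 ->
  (\int[@leb R]_(x in `[a, b]) (Y / ((x - c) ^+ 2 + Y ^+ 2)))%R =
  atan ((b - c) / Y) - atan ((a - c) / Y).
Proof.
move=> ab Y0; apply: (Rintegral_FTC (F := fun x => atan ((x - c) / Y))) => //.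
  by apply: continuous_quot => // x; exact: cvg_cst.
move=> x; have -> : Y / ((x - c) ^+ 2 + Y ^+ 2) =
    (1 + ((x - c) / Y) ^+ 2)^-1 * Y^-1.
  have := sum_sqr_gt0 (x - c) Y0 => /lt0r_neq0 h; field.
  by rewrite Y0 /= addrC h.
have d1 : is_derive x 1 (fun x : R => (x - c) / Y) Y^-1.
  by apply: is_derive_eq; rewrite /GRing.scale /=; ring.
exact: (is_derive1_comp (f := atan) (g := fun x => (x - c) / Y)).
Qed.

Lemma Rintegral_ln a b c Y : a <= b -> Y != 0 ->
  (\int[@leb R]_(x in `[a, b]) ((x - c) / ((x - c) ^+ 2 + Y ^+ 2)))%R =
  2^-1 * (ln ((b - c) ^+ 2 + Y ^+ 2) - ln ((a - c) ^+ 2 + Y ^+ 2)).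
Proof.
move=> ab Y0; rewrite mulrBr.
apply: (Rintegral_FTC (F := fun x => 2^-1 * ln ((x - c) ^+ 2 + Y ^+ 2))) => //.
  apply: continuous_quot => // x.
  by apply: cvgB; [exact: cvg_id|exact: cvg_cst].
move=> x; have p := sum_sqr_gt0 (x - c) Y0.
have d1 : is_derive x 1 (fun x : R => (x - c) ^+ 2 + Y ^+ 2) (2 * (x - c)).
  apply: is_derive_eq.
  by rewrite /GRing.scale /=; ring.
have d2 := @is_derive1_comp _ (@ln R) (fun x => (x - c) ^+ 2 + Y ^+ 2) x _ _
  (is_derive1_ln p) d1.
have d3 := is_deriveZ 2^-1 d2.
apply: (is_derive_eq d3); rewrite /GRing.scale /=.
by field; exact: lt0r_neq0.
Qed.

End line.

(** * Tonelli's theorem on rectangles *)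

Section rectangle.
Context {R : realType}.
Implicit Types (A B : set R) (f : R * R -> \bar R).

Lemma patch_setX A B f x y :
  (f \_ (A `*` B)) (x, y) = ((fun x => ((fun y => f (x, y)) \_ B) y) \_ A) x.
Proof.
rewrite !patchE; case: ifPn; rewrite ?notin_setE ?inE => /= h.
  by case: h => a b; rewrite !mem_set.
case: ifPn => //; rewrite inE => a; case: ifPn => //; rewrite inE => b.
by exfalso; exact: h.
Qed.

Lemma ge0_integral_setX1 A B f : measurable A -> measurable B ->
  measurable_fun setT f -> (forall z, 0 <= f z)%E ->
  (\int[@area R]_(z in A `*` B) f z =
   \int[@leb R]_(x in A) \int[@leb R]_(y in B) f (x, y))%E.
Proof.
move=> mA mB mf f0; have mAB : measurable (A `*` B) by exact: measurableX.
rewrite integral_area.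
rewrite integral_mkcond.
rewrite (fubini_tonelli1 (f \_ (A `*` B))).

- rewrite [RHS]integral_mkcond; apply: eq_integral => x _.
  rewrite /fubini_F patchE; case: ifPn => xA.
    rewrite [RHS]integral_mkcond; apply: eq_integral => y _.
    by rewrite patch_setX patchE xA.
  apply: integral0_eq => y _.
  by rewrite patch_setX patchE (negbTE xA).
- by apply/measurable_restrict => //; rewrite setTI; exact: measurable_funTS.
- by move=> z; rewrite patchE; case: ifP.
Qed.

Lemma ge0_integral_setX2 A B f : measurable A -> measurable B ->
  measurable_fun setT f -> (forall z, 0 <= f z)%E ->
  (\int[@area R]_(z in A `*` B) f z =
   \int[@leb R]_(y in B) \int[@leb R]_(x in A) f (x, y))%E.
Proof.
move=> mA mB mf f0; have mAB : measurable (A `*` B) by exact: measurableX.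
rewrite integral_area.
rewrite integral_mkcond.
rewrite (fubini_tonelli2 (f \_ (A `*` B))).

- rewrite [RHS]integral_mkcond; apply: eq_integral => y _.
  rewrite /fubini_G patchE; case: ifPn => yB.
    rewrite [RHS]integral_mkcond; apply: eq_integral => x _.
    by rewrite patch_setX !patchE yB.
  apply: integral0_eq => x _.
  by rewrite patch_setX !patchE (negbTE yB); case: ifP.
- by apply/measurable_restrict => //; rewrite setTI; exact: measurable_funTS.
- by move=> z; rewrite patchE; case: ifP.
Qed.

Lemma measurable_integral_section1 B f : measurable B ->
  measurable_fun setT f -> (forall z, 0 <= f z)%E ->
  measurable_fun setT (fun x => \int[@leb R]_(y in B) f (x, y))%E.
Proof.
move=> mB mf f0; have mTB : measurable ([set: R] `*` B) by exact: measurableX.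
under eq_fun do rewrite integral_mkcond.
have -> : (fun x => \int[@leb R]_y ((fun y => f (x, y)) \_ B) y)%E =
    fubini_F (@leb R) (f \_ ([set: R] `*` B)).
  apply/funext => x; apply: eq_integral => y _.
  by rewrite patch_setX [RHS]patchE in_setT.
apply: measurable_fun_fubini_tonelli_F.
- by apply/measurable_restrict => //; rewrite setTI; exact: measurable_funTS.
- by move=> z; rewrite patchE; case: ifP.
Qed.

Lemma measurable_integral_section2 A f : measurable A ->
  measurable_fun setT f -> (forall z, 0 <= f z)%E ->
  measurable_fun setT (fun y => \int[@leb R]_(x in A) f (x, y))%E.
Proof.
move=> mA mf f0.
apply: (@measurable_integral_section1 A (fun z => f (z.2, z.1))) => //.
apply: measurableT_comp => //.
by apply/measurable_fun_pairP; split; [exact: measurable_snd|exact: measurable_fst].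
Qed.

End rectangle.

(** * Local integrability of the Cauchy kernel for area *)

Section kernel.
Context {R : realType}.
Implicit Types (p z : R * R) (a b c x y Y : R).

(* Up to a factor 2 this is 1 / |z - p|, but each summand integrates exactly in
   one of the two variables. *)
Definition kernel_bound z p : R :=
  `|z.1 - p.1| / ((z.2 - p.2) ^+ 2 + (z.1 - p.1) ^+ 2) +
  `|z.2 - p.2| / ((z.1 - p.1) ^+ 2 + (z.2 - p.2) ^+ 2).

Lemma kernel_bound_ge0 z p : 0 <= kernel_bound z p.
Proof. by rewrite addr_ge0// divr_ge0// addr_ge0// sqr_ge0. Qed.

Lemma cmod_kernel_le z p : cmod (toC z - toC p)^-1 <= kernel_bound z p.
Proof.
rewrite (le_trans (cmod_le_ReIm _))//= normrN !normrM !normfV.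
have h u v : `|u ^+ 2 + v ^+ 2| = u ^+ 2 + v ^+ 2 :> R.
  by rewrite ger0_norm// addr_ge0// sqr_ge0.
by rewrite !h /kernel_bound [(z.1 - p.1) ^+ 2 + _]addrC.
Qed.

(** The primitive is an arctangent, whose values lie in an interval of length [pi]; for [Y = 0] the
    numerator vanishes. *)
Lemma atan_kernel_le a b c Y : a <= b ->
  (\int[@leb R]_(x in `[a, b]) (`|Y| / ((x - c) ^+ 2 + Y ^+ 2))%:E <= pi%:E)%E.
Proof.
move=> ab; have [->|Y0] := eqVneq Y 0.
  rewrite integral0_eq ?lee_fin ?pi_ge0// => x _.
  by rewrite normr0 mul0r.
have nY0 : `|Y| != 0 by rewrite normr_eq0.
rewrite -(real_normK (num_real Y)).
have i : (@leb R).-integrable `[a, b]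
    (EFin \o (fun x => `|Y| / ((x - c) ^+ 2 + `|Y| ^+ 2))).
  apply: leb_integrable_continuous; apply: continuous_quot => // x.
  exact: cvg_cst.
rewrite -(fineK (integrable_fin_num (measurable_itv _) i)) lee_fin.
rewrite -[leLHS]/(\int[@leb R]_(x in `[a, b])
  (`|Y| / ((x - c) ^+ 2 + `|Y| ^+ 2)))%R Rintegral_atan//.
have := atan_ltpi2 ((b - c) / `|Y|); have := atan_gtNpi2 ((a - c) / `|Y|).
by rewrite [leRHS]splitr; move: (atan _) (atan _) (_ / 2) => u v w; lra.
Qed.

Lemma measurable_quot d (T : measurableType d) (f g : T -> R) :
  measurable_fun setT f -> measurable_fun setT g ->
  measurable_fun setT (fun u => `|f u| / (g u ^+ 2 + f u ^+ 2)).
Proof.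
move=> mf mg; apply: measurable_funM; first exact: measurableT_comp.
apply: measurable_fun_inv; last by move=> u; rewrite addr_ge0// sqr_ge0.
by apply: measurable_funD; exact: measurable_funX.
Qed.

Lemma measurable_kernel_bound2 :
  measurable_fun setT (fun u : (R * R) * (R * R) => kernel_bound u.1 u.2).
Proof.
have m1 : measurable_fun setT (fun u : (R * R) * (R * R) => u.1.1 - u.2.1).
  apply: measurable_funB; apply: measurableT_comp measurable_fst _.
    exact: measurable_fst.
  exact: measurable_snd.
have m2 : measurable_fun setT (fun u : (R * R) * (R * R) => u.1.2 - u.2.2).
  apply: measurable_funB; apply: measurableT_comp measurable_snd _.
    exact: measurable_fst.
  exact: measurable_snd.
by apply: measurable_funD; exact: measurable_quot.
Qed.

Lemma measurable_kernel_bound p : measurable_fun setT (kernel_bound^~ p).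
Proof.
exact: (measurable_fun_pair1 p measurable_kernel_bound2).
Qed.

(** The first summand of the bound is integrated in [y] first and the second in [x] first. Each
    inner integral is at most [pi], which leaves a side length. The bound does not depend on [p], as
    Fubini's theorem against [mu] will require. *)
Lemma integral_kernel_bound_le a b c d p : a <= b -> c <= d ->
  (\int[@area R]_(z in `[a, b] `*` `[c, d]) (kernel_bound z p)%:E
   <= ((b - a + (d - c)) * pi)%:E)%E.
Proof.
move=> ab cd; have mD : measurable (`[a, b]%classic `*` `[c, d]%classic).
  exact: measurableX.
have m1 : measurable_fun setT (fun z : R * R => z.1 - p.1).
  by apply: measurable_funB => //; exact: measurable_fst.
have m2 : measurable_fun setT (fun z : R * R => z.2 - p.2).
  by apply: measurable_funB => //; exact: measurable_snd.
have n (f g : R * R -> R) : measurable_fun setT f -> measurable_fun setT g ->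
    measurable_fun setT (fun u => (`|f u| / (g u ^+ 2 + f u ^+ 2))%:E).
  by move=> mf mg; apply/measurable_EFinP; exact: measurable_quot.
have g0 (f g : R * R -> R) z : (0 <= (`|f z| / (g z ^+ 2 + f z ^+ 2))%:E)%E.
  by rewrite lee_fin divr_ge0// addr_ge0// sqr_ge0.
have f0 := g0 (fun z => z.1 - p.1) (fun z => z.2 - p.2).
have k0 := g0 (fun z => z.2 - p.2) (fun z => z.1 - p.1).
have mf := n _ _ m1 m2; have mk := n _ _ m2 m1.
under eq_integral do rewrite EFinD.
rewrite (ge0_integralD (@area R) mD (fun z _ => f0 z) (measurable_funTS mf)
  (fun z _ => k0 z) (measurable_funTS mk)).
rewrite mulrDl EFinD; apply: leeD.
- rewrite (ge0_integral_setX1 _ _ mf f0)//.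
  apply: (@le_trans _ _ (\int[@leb R]_(x in `[a, b]) (cst pi%:E x))%E).
    apply: ge0_le_integral => //=.
    + by move=> x _; apply: integral_ge0 => y _; exact: (f0 (x, y)).
    + apply: measurable_funTS.
      exact: (measurable_integral_section1 (measurable_itv _) mf f0).
    + by move=> x _; exact: atan_kernel_le.
  by rewrite integral_cst//= leb_itv// -EFinM mulrC.
- rewrite (ge0_integral_setX2 _ _ mk k0)//.
  apply: (@le_trans _ _ (\int[@leb R]_(x in `[c, d]) (cst pi%:E x))%E).
    apply: ge0_le_integral => //=.
    + by move=> x _; apply: integral_ge0 => y _; exact: (k0 (y, x)).
    + apply: measurable_funTS.
      exact: (measurable_integral_section2 (measurable_itv _) mk k0).
    + by move=> x _; exact: atan_kernel_le.
  by rewrite integral_cst//= leb_itv// -EFinM mulrC.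
Qed.

End kernel.

(** * The kernel over long horizontal segments *)

Section line_limit.
Context {R : realType}.
Implicit Types (a x y Y L M e : R).

(** For [v <= u] this is [ln (u / v) <= u / v - 1], then [v] is replaced by [m] in the
    denominator. *)
Lemma ln_dist_le (m u v : R) : 0 < m -> m <= u -> m <= v ->
  `|ln u - ln v| <= `|u - v| / m.
Proof.
wlog uv : u v / v <= u.
  move=> H m0 mu mv; have [vu|/ltW uv] := leP v u; first exact: H.
  by rewrite distrC [X in _ <= X / _]distrC; exact: H.
move=> m0 mu mv; have v0 := lt_le_trans m0 mv.
have u0 := lt_le_trans v0 uv.
rewrite !ger0_norm ?subr_ge0 ?ler_ln ?posrE//.
have := @le_ln1Dx R ((u - v) / v).
have -> : 1 + (u - v) / v = u / v by field; exact: lt0r_neq0.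
rewrite ln_div ?posrE// => /(_ _)/le_trans -> //.
  by rewrite (lt_le_trans (ltrN10 R))// divr_ge0 ?subr_ge0// ltW.
by rewrite ler_wpM2l ?subr_ge0// lef_pV2 ?posrE.
Qed.

(** The integral is half a difference of logarithms at the two ends. Their arguments differ by
    [4 (L + s) a] only and are at least [s ^+ 2], as each end is at distance at least [s] from
    [a]. *)
Lemma line_re_le L s a Y : 0 < L -> 0 < s -> `|a| <= L -> Y != 0 ->
  `|\int[@leb R]_(x in `[- (L + s), L + s]) ((x - a) / ((x - a) ^+ 2 + Y ^+ 2))|%R
    <= 2 * (L + s) * L / s ^+ 2.
Proof.
move=> L0 s0; rewrite ler_norml => /andP[aL La] Y0.
rewrite Rintegral_ln//; last by lra.
rewrite normrM ger0_norm ?invr_ge0//.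
have s20 : 0 < s ^+ 2 by rewrite exprn_gt0.
have Y20 : 0 <= Y ^+ 2 by rewrite sqr_ge0.
have h1 : s ^+ 2 <= (L + s - a) ^+ 2 + Y ^+ 2 by nra.
have h2 : s ^+ 2 <= (- (L + s) - a) ^+ 2 + Y ^+ 2 by nra.
rewrite (le_trans (ler_wpM2l _ (ln_dist_le s20 h1 h2)))// mulrA.
rewrite ler_wpM2r//; first by rewrite invr_ge0 ltW.
have -> : (L + s - a) ^+ 2 + Y ^+ 2 - ((- (L + s) - a) ^+ 2 + Y ^+ 2) =
  - (4 * (L + s) * a) by ring.
rewrite normrN !normrM (ger0_norm (_ : 0 <= L + s)); last by lra.
rewrite ger0_norm//.
have : `|a| <= L by rewrite ler_norml aL.
move: `|a| => t tL.
have : 0 <= (L + s) * (L - t) by rewrite mulr_ge0//; lra.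
by nra.
Qed.

(** The integral is odd in [Y]. For [Y > 0] it is the sum of the arctangents of [(L + s - a) / Y]
    and [(L + s + a) / Y]; both arguments are at least [s / (2 * L)], so both arctangents are within
    [e] of [pi / 2]. *)
Lemma line_im_le L s a Y e t0 : 0 < L -> 0 < s -> `|a| <= L -> Y != 0 ->
  `|Y| <= 2 * L -> t0 <= s / (2 * L) ->
  (forall t, t0 <= t -> pi / 2 - e <= atan t) ->
  `|\int[@leb R]_(x in `[- (L + s), L + s]) (Y / ((x - a) ^+ 2 + Y ^+ 2)) -
    Num.sg Y * pi|%R <= 2 * e.
Proof.
move=> L0 s0 aL.
wlog Y0 : Y / 0 < Y.
  move=> H Y0; have [Yp|Yn|Y00] := ltgtP 0 Y; first exact: H.
    move=> h1 h2 h3; have := H (- Y); rewrite oppr_eq0 oppr_gt0 normrN.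
    move=> /(_ Yn Y0 h1 h2 h3); rewrite sqrrN sgrN mulNr.
    have i : (@leb R).-integrable `[- (L + s), L + s]
        (EFin \o (fun x => Y / ((x - a) ^+ 2 + Y ^+ 2))).
      apply: leb_integrable_continuous; apply: continuous_quot => // x.
      exact: cvg_cst.
    have -> : (\int[@leb R]_(x in `[(- (L + s))%R, (L + s)%R])
        (- Y / ((x - a) ^+ 2 + Y ^+ 2)) =
        - \int[@leb R]_(x in `[(- (L + s))%R, (L + s)%R])
        (Y / ((x - a) ^+ 2 + Y ^+ 2)))%R.
      rewrite -[RHS]mulN1r -(RintegralZl _ (measurable_itv _) i).
      apply: eq_Rintegral => x _.
      by rewrite mulNr mulN1r.
    by rewrite -opprD normrN.
  by rewrite -Y00 eqxx in Y0.
move: aL; rewrite ler_norml => /andP[aL La] Yn0.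
rewrite (gtr0_norm Y0) => YL t0s ht.
rewrite Rintegral_atan//; last by lra.
rewrite gtr0_sg// mul1r.
have -> : (- (L + s) - a) / Y = - ((L + s + a) / Y) by rewrite -mulNr; congr (_ / _); ring.
rewrite atanN opprK.
have k u : s <= u -> pi / 2 - e <= atan (u / Y).
  move=> su; apply: ht; rewrite (le_trans t0s)//.
  apply: ler_pM => //; first exact: ltW.
    by rewrite invr_ge0 mulr_ge0// ltW.
  by rewrite lef_pV2 ?posrE// mulr_gt0.
have h1 := k (L + s - a) ltac:(lra).
have h2 := k (L + s + a) ltac:(lra).
have h3 := atan_ltpi2 ((L + s - a) / Y).
have h4 := atan_ltpi2 ((L + s + a) / Y).
rewrite [X in _ - X]splitr.
move: h1 h2 h3 h4; move: (atan _) (atan _) (_ / 2) => u v w.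
by rewrite ler_norml => *; apply/andP; split; lra.
Qed.

(** The point is that [M] serves all [a] and [Y] at once, even [Y] close to 0: a small [Y] only
    pushes the arctangents closer to their limits. *)
Lemma line_kernel_limit L e : 0 < L -> 0 < e -> exists2 M, L <= M &
  forall a Y, `|a| <= L -> Y != 0 -> `|Y| <= 2 * L ->
  `|\int[@leb R]_(x in `[- M, M]) ((x - a) / ((x - a) ^+ 2 + Y ^+ 2))|%R <= e /\
  `|\int[@leb R]_(x in `[- M, M]) (Y / ((x - a) ^+ 2 + Y ^+ 2)) -
    Num.sg Y * pi|%R <= e.
Proof.
move=> L0 e0.
have [t0 ht0] : exists t0 : R, forall t, t0 <= t -> pi / 2 - e / 2 <= atan t.
  have := @cvgy_atan R; move=> /cvgrPdist_le /(_ (e / 2)).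
  rewrite divr_gt0// => /(_ isT) [t0 [_ ht0]]; exists (t0 + 1) => t t0t.
  have /= := ht0 t; rewrite ler_norml => /(_ _)/andP[|_]; first by lra.
  by lra.
(* With [s >= L] the logarithmic bound is at most [4 * L / s], hence at most [e] by the second
   entry. The third entry brings the arctangents past the threshold [t0]. *)
pose s := Num.max (Num.max L (4 * L / e)) (t0 * (2 * L)).
have sL : L <= s by rewrite !le_max lexx.
have s0 : 0 < s by exact: lt_le_trans sL.
have se : 4 * L <= s * e by rewrite -ler_pdivrMr// !le_max lexx orbT.
have st : t0 <= s / (2 * L) by rewrite ler_pdivlMr ?mulr_gt0// !le_max lexx !orbT.
exists (L + s); first by lra.
move=> a Y aL Y0 YL; split.
  apply: le_trans (line_re_le L0 s0 aL Y0) _.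
  rewrite ler_pdivrMr ?exprn_gt0//.
  apply: (@le_trans _ _ (4 * L * s)); first by nra.
  by rewrite expr2 mulrA; apply: ler_wpM2r; [exact: ltW|rewrite [leRHS]mulrC].
by apply: le_trans (line_im_le L0 s0 aL Y0 YL st ht0) _; rewrite mulrC divfK.
Qed.

End line_limit.

(** * The Cauchy kernel paired with a function of the height on a box *)

Section box.
Context {R : realType}.
Implicit Types (p z : R * R) (L M : R) (psi Psi : R -> R).

Lemma cintegrable_area (F : R * R -> R[i]) :
  cintegrable (@area R) F <-> cintegrable (leb \x leb)%E F.
Proof.
suff h (f : R * R -> \bar R) :
    (@area R).-integrable setT f <-> (leb \x leb)%E.-integrable setT f.
  by rewrite /cintegrable; split => -[/h ? /h ?].
split=> /integrableP[mf fi]; apply/integrableP; split => //.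
  by rewrite -integral_area.
by rewrite integral_area.
Qed.

Lemma cint_area (F : R * R -> R[i]) :
  cint (@area R) F = cint (leb \x leb)%E F.
Proof. by congr Complex; rewrite /Rintegral integral_area. Qed.

(** The half-height [L] is dictated by the support; only the half-width [M] will grow, so that the
    horizontal sections approach full lines. *)
Definition box_weight L M psi z : R :=
  \1_(`[- M, M]%classic `*` `[- L, L]%classic) z * psi z.2.

Lemma measurable_box_weight L M psi : continuous psi ->
  measurable_fun setT (box_weight L M psi).
Proof.
move=> cpsi; apply: measurable_funM.
  by apply: measurable_indic; exact: measurableX.
apply: measurableT_comp measurable_snd.
exact: continuous_measurable_fun.
Qed.

Lemma integrable_box_kernel L M p : 0 <= L -> 0 <= M ->
  (@area R).-integrable setT (EFin \o (fun z =>
    \1_(`[- M, M]%classic `*` `[- L, L]%classic) z * kernel_bound z p)).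
Proof.
move=> L0 M0; set D := `[- M, M]%classic `*` `[- L, L]%classic.
have mD : measurable D by exact: measurableX.
have -> : EFin \o (fun z => \1_D z * kernel_bound z p) =
    (EFin \o (kernel_bound^~ p)) \_ D.
  apply/funext => z; rewrite patchE /= indicE.
  by case: ifP => _ /=; rewrite ?mul1r ?mul0r.
apply/(integrable_mkcond _ mD)/integrableP; split.
  by apply/measurable_EFinP/measurable_funTS; exact: measurable_kernel_bound.
under eq_integral do rewrite gee0_abs ?lee_fin ?kernel_bound_ge0//.
apply: le_lt_trans (integral_kernel_bound_le p _ _) (ltry _); lra.
Qed.

Lemma cmeas_kernel p : cmeas (fun z : R * R => (toC z - toC p)^-1).
Proof.
apply: cmeasV; apply: cmeasD; first exact: cmeas_toC.
exact: cmeas_cst.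
Qed.

Lemma cmod_box_kernel_le L M psi S p z : (forall y, `|y| <= L -> `|psi y| <= S) ->
  cmod (((box_weight L M psi z)%:C)%C * (toC z - toC p)^-1) <=
  S * (\1_(`[- M, M]%classic `*` `[- L, L]%classic) z * kernel_bound z p).
Proof.
move=> hS; rewrite cmodM cmod_real normrM mulrA ler_pM ?cmod_ge0 ?mulr_ge0//.
  rewrite indicE; case: (boolP (_ \in _)); last by rewrite normr0 !(mul0r, mulr0).
  rewrite inE => -[_ /=]; rewrite in_itv/= => /andP[y1 y2].
  by rewrite normr1 mul1r mulr1 hS// ler_norml y1.
exact: cmod_kernel_le.
Qed.

Lemma cintegrable_box_kernel L M psi S p : 0 <= L -> 0 <= M -> continuous psi ->
  (forall y, `|y| <= L -> `|psi y| <= S) ->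
  cintegrable (@area R)
    (fun z => ((box_weight L M psi z)%:C)%C * (toC z - toC p)^-1).
Proof.
move=> L0 M0 cpsi hS.
apply: (cintegrable_le _ (integrableZl measurableT S (integrable_box_kernel p L0 M0))).
  by apply: cmeasM; [apply: cmeas_real; exact: measurable_box_weight|exact: cmeas_kernel].
by move=> z; exact: cmod_box_kernel_le.
Qed.

Lemma continuous_bounded_itv psi L : 0 <= L -> continuous psi ->
  exists2 S, 0 <= S & forall y, `|y| <= L -> `|psi y| <= S.
Proof.
move=> L0 cpsi.
have [c _ hc] : exists2 c, c \in `[- L, L]%R &
    forall t, t \in `[- L, L]%R -> `|psi t| <= `|psi c|.
  apply: (@EVT_max _ (fun y => `|psi y|)); first by lra.
  apply: continuous_subspaceT => x.
  by apply: cvg_norm; exact: cpsi.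
by exists `|psi c| => // y; rewrite ler_norml => h; apply: hc; rewrite in_itv.
Qed.

(** The sign splits the integral into the one over [[b, L]] minus the one over [[- L, b]]; at
    [y = b] the two restrictions cancel. *)
Lemma Rintegral_sign_weight L psi Psi b : `|b| <= L -> continuous psi ->
  (forall x : R, is_derive x 1 Psi (psi x)) ->
  (@leb R).-integrable setT (EFin \o (fun y =>
     \1_`[- L, L]%classic y * psi y * Num.sg (y - b))) /\
  (\int[@leb R]_(y in setT) (\1_`[(- L)%R, L]%classic y * psi y * Num.sg (y - b)) =
   Psi L + Psi (- L) - 2 * Psi b)%R.
Proof.
rewrite ler_norml => /andP[Lb bL] cpsi dPsi.
have e : (fun y => \1_`[- L, L]%classic y * psi y * Num.sg (y - b)) =
    (psi \_ `[b, L]) \- (psi \_ `[- L, b]).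
  apply/funext => y /=; rewrite !patchE indicE !mem_setE !in_itv/= /point/=.
  have [yb|yb|->] := ltgtP y b.
  - rewrite (le_trans (ltW yb) bL) andbT ltr0_sg ?subr_lt0//.
    by case: (- L <= y) => /=; rewrite ?mul1r ?mul0r; ring.
  - rewrite (le_trans Lb (ltW yb)) gtr0_sg ?subr_gt0//=.
    by case: (y <= L) => /=; rewrite ?mul1r ?mul0r; ring.
  - by rewrite subrr sgr0 Lb bL/= subrr mulr0.
have i u v : (@leb R).-integrable setT (EFin \o (psi \_ `[u, v])).
  have := leb_integrable_continuous u v cpsi.
  by move/(integrable_mkcond _ (measurable_itv _)); rewrite restrict_EFin.
rewrite e; split.
  exact: (integrableB measurableT (i b L) (i (- L) b)).
rewrite RintegralB// -!Rintegral_mkcond.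
by rewrite !(Rintegral_FTC (F := Psi))//; ring.
Qed.

End box.

Section box_limit.
Context {R : realType}.
Implicit Types (p z : R * R) (L M : R) (psi Psi : R -> R).

Lemma cint_box_kernel_section L M psi p y : - M <= M -> y != p.2 ->
  cint (@leb R) (fun x => ((box_weight L M psi (x, y))%:C)%C *
    (toC (x, y) - toC p)^-1) =
  ((\1_`[- L, L]%classic y * psi y)%:C)%C * Complex
    (\int[@leb R]_(x in `[(- M)%R, M]) ((x - p.1) / ((x - p.1) ^+ 2 + (y - p.2) ^+ 2)))%R
    (- (\int[@leb R]_(x in `[(- M)%R, M]) ((y - p.2) / ((x - p.1) ^+ 2 + (y - p.2) ^+ 2)))%R).
Proof.
move=> MM yp; have Y0 : y - p.2 != 0 by rewrite subr_eq0.
have i1 : (@leb R).-integrable `[- M, M] (EFin \o (fun x =>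
    (x - p.1) / ((x - p.1) ^+ 2 + (y - p.2) ^+ 2))).
  apply: leb_integrable_continuous; apply: continuous_quot => // x.
  by apply: cvgB; [exact: cvg_id|exact: cvg_cst].
have i2 : (@leb R).-integrable `[- M, M] (EFin \o (fun x =>
    (y - p.2) / ((x - p.1) ^+ 2 + (y - p.2) ^+ 2))).
  apply: leb_integrable_continuous; apply: continuous_quot => // x.
  exact: cvg_cst.
have w x : box_weight L M psi (x, y) =
    \1_`[- M, M]%classic x * (\1_`[- L, L]%classic y * psi y).
  rewrite /box_weight /= mulrA; congr (_ * _); rewrite !indicE -natrM mulnb.
  by congr (_%:R); congr nat_of_bool; rewrite !mem_setE in_setX !mem_setE.
set c := \1_`[- L, L]%classic y * psi y.
apply/eqP; rewrite eq_complex /=; apply/andP; split; apply/eqP.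
  rewrite mul0r subr0 -(RintegralZl c (measurable_itv _) i1).
  rewrite [RHS]Rintegral_mkcond; apply: eq_Rintegral => x _.
  rewrite w -/c patchE mem_setE indicE mem_setE /point/=.
  by case: ifP => _ /=; rewrite ?mul0r ?mul1r ?mul0r subr0.
rewrite mul0r addr0 mulrN -(RintegralZl c (measurable_itv _) i2) -[RHS]mulN1r.
have i3 : (@leb R).-integrable `[- M, M] (EFin \o (fun x =>
    c * ((y - p.2) / ((x - p.1) ^+ 2 + (y - p.2) ^+ 2)))).
  exact: (integrableZl (measurable_itv _) c i2).
rewrite -(RintegralZl (-1) (measurable_itv _) i3) [RHS]Rintegral_mkcond.
apply: eq_Rintegral => x _.
rewrite w -/c patchE mem_setE indicE mem_setE /point/=.
by case: ifP => _ /=; rewrite ?mul0r ?mul1r ?mul0r addr0// mulN1r mulrN.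
Qed.

(** Integrating in [x] first turns the section at height [y] into nearly
    [- i pi psi(y) sgn (y - Im p)], and integrating this in [y] is [Rintegral_sign_weight]. The
    error is uniform in [p], hence can later be integrated against [mu]. *)
Lemma box_kernel_limit L psi Psi e : 0 < L -> continuous psi ->
  (forall x : R, is_derive x 1 Psi (psi x)) -> 0 < e ->
  exists2 M, L <= M & forall p, `|p.1| <= L -> `|p.2| <= L ->
    cmod (cint (@area R) (fun z => ((box_weight L M psi z)%:C)%C *
      (toC z - toC p)^-1) -
      Complex 0 (- pi * (Psi L + Psi (- L) - 2 * Psi p.2))) <= e.
Proof.
move=> L0 cpsi dPsi e0; have [S S0 hS] := continuous_bounded_itv (ltW L0) cpsi.
(* Each of the two components errs by at most [e / k] on a line; weighting by [S] and integrating
   over a height [2 * L] gives [4 * S * L * (e / k)]. The added 1 keeps [k] positive. *)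
pose k := 4 * S * L + 1; have k0 : 0 < k.
  by rewrite ltr_wpDl// !mulr_ge0// ltW.
have [M LM hM] := line_kernel_limit L0 (divr_gt0 e0 k0).
exists M => // p pa pb; have M0 : 0 <= M by lra.
have iF := (cintegrable_area _).1 (cintegrable_box_kernel p (ltW L0) M0 cpsi hS).
rewrite cint_area -(cint_prod2 iF).
set G := fun y => cint _ _; have iG : cintegrable (@leb R) G := cintegrable_cint2 iF.
have [isg Isg] := Rintegral_sign_weight pb cpsi dPsi.
pose T y := Complex 0 (- pi * (\1_`[- L, L]%classic y * psi y * Num.sg (y - p.2))).
have iT : cintegrable (@leb R) T.
  split; first exact: integrable0.
  exact: (integrableZl measurableT (- pi) isg).
have -> : Complex 0 (- pi * (Psi L + Psi (- L) - 2 * Psi p.2)) = cint (@leb R) T.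
  congr Complex; first by rewrite /= /Rintegral integral0.
  by rewrite -Isg -RintegralZl.
rewrite -cintB//; have iD := cintegrableB iG iT.
apply: le_trans (cmod_cint_le iD) _; set D := fun x => G x - T x in iD *.
have mb : measurable (~` [set p.2]) by exact: measurableC.
have md : measurable_fun setT (fun y => \1_(~` [set p.2]) y * cmod (D y)).
  apply: measurable_funM; first exact: measurable_indic.
  exact: (measurable_cmod (cintegrable_cmeas iD)).
(* The line through [p] itself is excluded, since the section estimates require [y - p.2 != 0]; it
   is a single height, of measure 0. *)
rewrite (@ae_eq_Rintegral _ _ _ _ _ (fun y => \1_(~` [set p.2]) y * cmod (D y)))//.
- have id : (@leb R).-integrable setT (EFin \o (fun y => \1_(~` [set p.2]) y * cmod (D y))).
    apply: le_integrable (cintegrable_cmod iD) => //; first exact/measurable_EFinP.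
    move=> y _; rewrite lee_fin /= normrM ler_piMl//.
    by rewrite indicE; case: (_ \in _); rewrite ?normr1// normr0.
  have i1 : (@leb R).-integrable setT (EFin \o \1_`[- L, L]%classic).
    have := leb_integrable_continuous (- L) L (@cst_continuous R R 1).
    move/(integrable_mkcond _ (measurable_itv _)); rewrite restrict_EFin.
    apply: eq_integrable => // y _ /=.
    by rewrite patchE mem_setE indicE mem_setE /point/=; case: ifP.
  apply: (@le_trans _ _ (\int[@leb R]_(y in setT)
      (S * (2 * (e / k)) * \1_`[(- L)%R, L]%classic y))%R).
    apply: le_Rintegral => //; first exact: (integrableZl measurableT _ i1).
    move=> y _; rewrite [X in X * _ <= _]indicE in_setC.
    have [yp|yp] := eqVneq y p.2.
      rewrite (mem_set (_ : [set p.2] y))//= mul0r.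
      by rewrite mulr_ge0// mulr_ge0// mulr_ge0// ltW// divr_gt0.
    rewrite memNset; last exact/eqP.
    rewrite mul1r.
    have MM : - M <= M by lra.
    have GE : G y = _ := cint_box_kernel_section L psi MM yp.
    have -> : D y = G y - T y by [].
    rewrite GE.
    set I1 := (\int[_]_(_ in _) _)%R; set I2 := (\int[_]_(_ in _) _)%R.
    have IE : \1_`[- L, L]%classic y = (- L <= y <= L)%R%:R :> R.
      by rewrite indicE mem_setE in_itv.
    have -> : T y = (((- L <= y <= L)%R%:R * psi y)%:C)%C *
        Complex 0 (- (Num.sg (y - p.2) * pi)).
      by rewrite /T IE; apply/eqP; rewrite eq_complex /=; apply/andP; split;
        apply/eqP; ring.
    rewrite IE.
    rewrite -mulrBr cmodM cmod_real mulrC normrM.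
    case: (boolP (_ <= y <= _)) => [yL|_]; last by rewrite normr0 mul0r !mulr0.
    rewrite normr1 mul1r mulr1 mulrC ler_pM ?cmod_ge0//.
      by rewrite hS// ler_norml.
    have Y0 : y - p.2 != 0 by rewrite subr_eq0.
    have YL : `|y - p.2| <= 2 * L.
      by rewrite (le_trans (ler_normB _ _))// mulr2n mulrDl !mul1r lerD// ler_norml.
    have [h1 h2] := hM _ _ pa Y0 YL.
    rewrite (le_trans (cmod_le_ReIm _))//= subr0 mulr2n mulrDl !mul1r lerD//.
    by rewrite -opprB opprK addrC normrN.
  rewrite RintegralZl//.
  have -> : (\int[@leb R]_(y in setT) (\1_`[(- L)%R, L]%classic y))%R = 2 * L.
    transitivity (fine (@leb R `[- L, L]%classic)).
      by rewrite /Rintegral integral_indic// setIT.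
    by rewrite leb_itv /=; [ring|lra].
  rewrite -[leRHS](divfK (lt0r_neq0 k0)) mulrC [leRHS]mulrC.
  rewrite /k; have := divr_ge0 (ltW e0) (ltW k0); rewrite -/k.
  move: (e / k) => t t0; have -> : 2 * L * (S * (2 * t)) = 4 * S * L * t by ring.
  by rewrite ler_wpM2r// lerDl.
- exact: (measurable_cmod (cintegrable_cmeas iD)).
- exists [set p.2]; split => //; first exact: leb_set1.
  move=> y /=; apply: contra_notP => yp.
  have h : \1_(~` [set p.2]) y = 1 :> R.
    by rewrite indicE (mem_set (yp : (~` [set p.2]) y)).
  by rewrite h mul1r.
Qed.

End box_limit.

(** * Separating a point from a convex compact set by a disc *)

Section separating_disc.
Context {R : realType}.
Implicit Types (K : set (R * R)) (z c : R[i]) (p : R * R).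

Lemma compact_cmod_bounded K : compact K ->
  exists2 B : R, 0 <= B & forall p, K p -> cmod (toC p) <= B.
Proof.
move=> /compact_bounded [M [_ hM]].
have := hM (Num.max M 0 + 1); rewrite (le_lt_trans (_ : M <= Num.max M 0)) ?ltrDl//; last first.
  by rewrite le_max lexx.
(* The norm of [R * R] is the maximum of the coordinates, whence the factor 2 for the modulus. *)
move=> /(_ isT) h; exists (2 * (Num.max M 0 + 1)).
  by rewrite mulr_ge0// addr_ge0// le_max lexx orbT.
move=> p Kp; have : `|p| <= Num.max M 0 + 1 := h p Kp.
rewrite prod_normE ge_max => /andP[p1 p2].
by rewrite (le_trans (cmod_le_ReIm _))//= mulr2n mulrDl !mul1r lerD.
Qed.

Lemma nearest_point K z : compact K -> K !=set0 -> exists2 k, K k &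
  forall p, K p -> cmod (z - toC k) ^+ 2 <= cmod (z - toC p) ^+ 2.
Proof.
move=> cK K0.
have cf : continuous (fun p : R * R => cmod (z - toC p) ^+ 2).
  have -> : (fun p : R * R => cmod (z - toC p) ^+ 2) = fun p =>
      (complex.Re z - p.1) * (complex.Re z - p.1) +
      (complex.Im z - p.2) * (complex.Im z - p.2).
    by apply/funext => p; rewrite cmod_sqr !expr2; case: z => a b.
  move=> p.
  have h1 : complex.Re z - q.1 @[q --> p] --> complex.Re z - p.1.
    by apply: cvgB; [exact: cvg_cst|exact: cvg_fst].
  have h2 : complex.Im z - q.2 @[q --> p] --> complex.Im z - p.2.
    by apply: cvgB; [exact: cvg_cst|exact: cvg_snd].
  by apply: cvgD; apply: cvgM.
have [k] := compact_EVT_min K0 cK (continuous_subspaceT cf).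
rewrite inE => Kk hk; exists k => // p Kp; apply: hk; exact/mem_set.
Qed.

(** If [k] is the point of [K] nearest to [z], then [K] lies in the half-plane through [k]
    orthogonal to [z - k]. A large enough disc centred far behind [k] on that normal contains the
    bounded part of the half-plane where [K] lies, but not [z]. *)
Lemma convex_compact_disc K z : compact K -> convex_set K -> ~ K (ofC z) ->
  exists c r, [/\ 0 <= r, forall p, K p -> cmod (toC p - c) <= r &
    r < cmod (z - c)].
Proof.
move=> cK xK zK; have [K0|/set0P/negP] := pselect (K !=set0); last first.
  rewrite negbK => /eqP ->; exists (z - 1), 0; split => //.
  by rewrite subKr cmod1.
have [k Kk hk] := nearest_point z cK K0.
have [B B0 hB] := compact_cmod_bounded cK.
pose u := z - toC k.
have u0 : 0 < cmod u.
  rewrite cmod_gt0 subr_eq0; apply: contra_notN zK => /eqP ->.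
  by rewrite toCK.
pose dot (v w : R[i]) := complex.Re v * complex.Re w + complex.Im v * complex.Im w.
have expand (v w : R[i]) (t : R) :
    cmod (v - (t%:C)%C * w) ^+ 2 = cmod v ^+ 2 - 2 * t * dot v w + t ^+ 2 * cmod w ^+ 2.
  by rewrite !cmod_sqr /dot; case: v w => a b [a' b'] /=; ring.
have hdot p : K p -> dot u (toC p - toC k) <= 0.
  move=> Kp; set v := toC p - toC k; rewrite leNgt; apply/negP => d0.
  (* This denominator makes [t <= 1] and [t |v|^2 <= dot u v] at once. Then moving from [k] towards
     [p] by [t] changes the squared distance to [z] by at most [- t (dot u v) < 0], against
     minimality. *)
  pose D := cmod v ^+ 2 + dot u v.
  have D0 : 0 < D by rewrite ltr_wpDl// sqr_ge0.
  pose t := dot u v / D.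
  have t0 : 0 < t by rewrite divr_gt0.
  have t1 : t <= 1 by rewrite ler_pdivrMr// mul1r lerDr sqr_ge0.
  have := xK p k (Itv01 (ltW t0) t1) (mem_set Kp) (mem_set Kk).
  rewrite inE => /hk.
  have -> : z - toC (conv (Itv01 (ltW t0) t1) (p : convex_lmodType _) k) =
      u - (t%:C)%C * v.
    rewrite (_ : toC _ = toC k + (t%:C)%C * v); first by rewrite opprD addrA.
    apply/eqP; rewrite eq_complex /=.
    by apply/andP; split; apply/eqP; rewrite /GRing.scale /= /unstable.onem; ring.
  rewrite expand -/v.
  have h : t * cmod v ^+ 2 <= dot u v.
    by rewrite mulrAC ler_pdivrMr//; apply: ler_wpM2l; [exact: ltW|rewrite /D lerDl ltW].
  have : 0 < t * dot u v by rewrite mulr_gt0.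
  have : t * (t * cmod v ^+ 2) <= t * dot u v by rewrite ler_wpM2l// ltW.
  by rewrite mulrA -expr2; lra.
pose d := cmod u ^+ 2; have d0 : 0 < d by rewrite exprn_gt0.
pose V := (2 * B) ^+ 2; have V0 : 0 <= V by rewrite sqr_ge0.
(* The centre will be [z - s u]. There [|p - c|^2 <= V + (s - 1)^2 d] on [K], and this is below
   [|z - c|^2 = s^2 d] exactly when [V < (2 s - 1) d]; the choice [s d = V + d] gives
   [(2 s - 1) d = 2 V + d]. *)
pose s := V / d + 1.
have s1 : 1 <= s by rewrite lerDr divr_ge0// ltW.
have sV : s * d = V + d by rewrite mulrDl mul1r divfK// lt0r_neq0.
exists (z - (s%:C)%C * u), (Num.sqrt (V + (s - 1) ^+ 2 * d)); split.
- exact: sqrtr_ge0.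
- move=> p Kp; rewrite -(ler_pXn2r (n := 2)) ?nnegrE ?cmod_ge0 ?sqrtr_ge0//.
  rewrite sqr_sqrtr; last by rewrite addr_ge0// mulr_ge0 ?sqr_ge0// ltW.
  have -> : toC p - (z - (s%:C)%C * u) = (toC p - toC k) - ((1 - s)%:C)%C * u.
    by rewrite /u rmorphB rmorph1; ring.
  rewrite expand.
  have : cmod (toC p - toC k) ^+ 2 <= V.
    rewrite ler_pXn2r ?nnegrE ?cmod_ge0 ?mulr_ge0//.
    by rewrite (le_trans (cmodB_le _ _))// mulr2n mulrDl !mul1r lerD// hB.
  have : 0 <= (s - 1) * - dot (toC p - toC k) u.
    rewrite mulr_ge0 ?subr_ge0// lerNr oppr0.
    by have := hdot p Kp; rewrite /dot [complex.Re u * _]mulrC [complex.Im u * _]mulrC.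
  rewrite -/d -[(1 - s) ^+ 2]sqrrN opprB; move: (cmod _ ^+ 2) (dot _ _) => x y.
  by nra.
- have -> : z - (z - (s%:C)%C * u) = (s%:C)%C * u by rewrite subKr.
  rewrite -(ltr_pXn2r (n := 2)) ?nnegrE ?cmod_ge0 ?sqrtr_ge0//.
  rewrite sqr_sqrtr; last by rewrite addr_ge0// mulr_ge0 ?sqr_ge0// ltW.
  rewrite cmodM cmod_real exprMn real_normK ?num_real// -/d.
  have -> : s ^+ 2 * d = V + d + s * d + (s - 1) ^+ 2 * d - d.
    rewrite -sV; ring.
  rewrite sV; nra.
Qed.

End separating_disc.

(** * Polynomials near infinity *)

Section complex_poly.
Context {R : realType}.
Implicit Types (P Q g : {poly R[i]}) (z : R[i]).

Lemma horner_bounded g (B : R) : exists2 C : R, 0 <= C &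
  forall z, cmod z <= B -> cmod g.[z] <= C.
Proof.
elim/poly_ind: g => [|g c [C C0 IH]].
  by exists 0 => // z _; rewrite horner0 cmod0.
exists (C * `|B| + cmod c).
  by rewrite addr_ge0 ?mulr_ge0 ?cmod_ge0.
move=> z zB; rewrite hornerMXaddC (le_trans (cmodD_le _ _))// lerD2r cmodM.
by rewrite ler_pM ?cmod_ge0 ?IH// (le_trans zB)// ler_norm.
Qed.

Definition vanishes_at_infinity (F : R[i] -> R[i]) : Prop :=
  forall e : R, 0 < e -> exists r : R, forall z, r < cmod z -> cmod (F z) <= e.

Lemma vanishes_at_infinity_cst (c : R[i]) : vanishes_at_infinity (fun=> c) -> c = 0.
Proof.
move=> h; apply/eqP; rewrite -cmod_eq0 eq_le cmod_ge0 andbT.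
apply/ler_addgt0Pl => e e0; rewrite addr0; have [r hr] := h e e0.
apply: (hr (((`|r| + 1)%:C)%C)).
rewrite cmod_real ger0_norm ?addr_ge0//.
by rewrite (le_lt_trans (ler_norm _))// ltrDl.
Qed.

Lemma poly_vanishes_at_infinity P : vanishes_at_infinity (horner P) -> P = 0.
Proof.
elim/poly_ind: P => // P c IH h.
have P0 : P = 0.
  apply: IH => e e0; have [r hr] := h 1 ltr01.
  (* Where [|P(z) z + c| <= 1], one has [|P(z)| <= (1 + |c|) / |z|], so [P] itself vanishes at
     infinity and the induction applies. *)
  exists (Num.max r (Num.max 0 ((1 + cmod c) / e))) => z.
  rewrite !gt_max => /and3P[/hr + z0]; rewrite ltr_pdivrMr// => + ze.
  rewrite hornerMXaddC => hz.
  rewrite -(ler_pM2r z0) -cmodM.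
  rewrite -[X in cmod X](addrK c) (le_trans (cmodB_le _ _))//.
  by rewrite [leRHS]mulrC ltW// (le_lt_trans _ ze)// lerD2r.
have : vanishes_at_infinity (fun=> c).
  move=> e /h[r hr]; exists r => z /hr.
  by rewrite P0 hornerMXaddC horner0 mul0r add0r.
by move=> /vanishes_at_infinity_cst ->; rewrite P0 mul0r add0r.
Qed.

Lemma horner_neq0_far Q : Q != 0 ->
  exists r : R, forall z, r < cmod z -> Q.[z] != 0.
Proof.
move=> Q0; have [s Qs] := closed_field_poly_normal Q.
exists (\sum_(x <- s) cmod x) => z; apply: contraTN => /eqP Qz.
have : z \in s.
  rewrite -root_prod_XsubC; move/eqP: Qz.
  by rewrite Qs hornerZ mulf_eq0 lead_coef_eq0 (negbTE Q0).
rewrite -leNgt; elim: s {Qs} => // x s IH; rewrite inE big_cons.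
move=> /predU1P[->|/IH]; first by rewrite lerDl sumr_ge0// => *; exact: cmod_ge0.
by move=> h; rewrite (le_trans h)// lerDr cmod_ge0.
Qed.

Lemma vanishes_near_infinity_poly P (r : R) :
  (forall z, r < cmod z -> P.[z] = 0) -> P = 0.
Proof.
move=> h; apply: poly_vanishes_at_infinity => e e0; exists r => z /h ->.
by rewrite cmod0 ltW.
Qed.

End complex_poly.

Lemma measurable_point (R : realType) (p : R * R) : measurable [set p].
Proof. by apply: compact_measurable2; exact: compact_set1. Qed.

(** * Cauchy transforms of polynomial multiples of a supported measure *)

Section supported_measure.
Context {R : realType}.
Variables (mu : {finite_measure set (R * R)%type -> \bar R}) (K : set (R * R)).
Hypotheses (mK : measurable K) (muK : mu (~` K) = 0%E).

Definition mass : R := fine (mu setT).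

Lemma mass_ge0 : 0 <= mass.
Proof. exact: fine_ge0. Qed.

Lemma ae_supported : {ae mu, forall p, K p}.
Proof. by exists (~` K); split => //; exact: measurableC. Qed.

(* Cutting off outside K changes nothing almost everywhere and turns bounds on
   K into global bounds. *)
Lemma cutoff_ae (F : R * R -> R[i]) :
  {ae mu, forall p, F p = (((\1_K p)%:C)%C * F p)}.
Proof.
by apply: filterS ae_supported => p Kp; rewrite indicE mem_set// mul1r.
Qed.

Lemma cmeas_cutoff (F : R * R -> R[i]) : cmeas F ->
  cmeas (fun p => ((\1_K p)%:C)%C * F p).
Proof. by move=> mF; apply: cmeasM => //; apply: cmeas_real; exact: measurable_indic. Qed.

Lemma cmod_cutoff_le (F : R * R -> R[i]) (C : R) p : 0 <= C ->
  (K p -> cmod (F p) <= C) -> cmod (((\1_K p)%:C)%C * F p) <= C.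
Proof.
move=> C0 FC; rewrite cmodM cmod_real indicE; case: (boolP (_ \in _)).
  by rewrite inE => /FC; rewrite normr1 mul1r.
by rewrite normr0 mul0r.
Qed.

Lemma cintegrable_bounded F (C : R) : cmeas F -> 0 <= C ->
  (forall p, K p -> cmod (F p) <= C) -> cintegrable mu F.
Proof.
move=> mF C0 FC.
apply: (@ae_eq_cintegrable _ _ _ mu (fun p => ((\1_K p)%:C)%C * F p)) => //.
  by apply: filterS (cutoff_ae F) => p /esym.
apply: (cintegrable_le _ (finite_measure_integrable_cst mu C measurableT)).
  exact: cmeas_cutoff.
by move=> p; apply: cmod_cutoff_le => //; exact: FC.
Qed.

Lemma cmod_cint_bounded F (C : R) : cmeas F -> 0 <= C ->
  (forall p, K p -> cmod (F p) <= C) -> cmod (cint mu F) <= C * mass.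
Proof.
move=> mF C0 FC; have mG := cmeas_cutoff mF.
rewrite (ae_eq_cint mF mG (cutoff_ae F)).
have G C1 : (forall p, cmod (((\1_K p)%:C)%C * F p) <= C1) ->
    cintegrable mu (fun p => ((\1_K p)%:C)%C * F p).
  by move=> h; apply: (cintegrable_le mG (finite_measure_integrable_cst mu C1 measurableT)).
have hC p : cmod (((\1_K p)%:C)%C * F p) <= C.
  by apply: cmod_cutoff_le => //; exact: FC.
have iG := G _ hC.
apply: le_trans (cmod_cint_le iG) _.
apply: (@le_trans _ _ (\int[mu]_(p in setT) C)%R).
  by apply: le_Rintegral => //; [exact: cintegrable_cmod|exact: finite_measure_integrable_cst].
by rewrite Rintegral_cst.
Qed.

Lemma cintegrable_mul_bounded F G (C : R) : cmeas G -> 0 <= C ->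
  (forall p, K p -> cmod (G p) <= C) -> cintegrable mu F ->
  cintegrable mu (fun p => G p * F p).
Proof.
move=> mG C0 GC iF.
apply: (@ae_eq_cintegrable _ _ _ mu (fun p => (((\1_K p)%:C)%C * G p) * F p)).
- by apply: cmeasM => //; exact: cintegrable_cmeas iF.
- by apply: filterS (cutoff_ae G) => p <-.
apply: (cintegrableMl (C := C)) => //; first exact: cmeas_cutoff.
by move=> p; apply: cmod_cutoff_le => //; exact: GC.
Qed.

Variable B : R.
Hypothesis KB : forall p, K p -> cmod (toC p) <= B.

Lemma cmeas_poly (g : {poly R[i]}) : cmeas (fun p : R * R => g.[toC p]).
Proof. by apply: cmeas_horner; exact: cmeas_toC. Qed.

Lemma poly_bounded (g : {poly R[i]}) : exists2 C : R, 0 <= C &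
  forall p, K p -> cmod g.[toC p] <= C.
Proof.
have [C C0 hC] := horner_bounded g B.
by exists C => // p /KB; exact: hC.
Qed.

Lemma cintegrable_poly (g : {poly R[i]}) : cintegrable mu (fun p => g.[toC p]).
Proof.
have [C C0 hC] := poly_bounded g.
exact: cintegrable_bounded (cmeas_poly g) C0 hC.
Qed.

Definition moment (g : {poly R[i]}) : R[i] := cint mu (fun p => g.[toC p]).

(** This is the Cauchy transform of the complex measure [g mu], kept as an integral against the
    positive measure [mu]. *)
Definition transform (g : {poly R[i]}) (z : R[i]) : R[i] :=
  cint mu (fun p => g.[toC p] * (z - toC p)^-1).

(** Atoms at [z] are excluded because [0^-1 = 0]: the cancellation [(z - p) (z - p)^-1 = 1] fails at
    [p = z] and must be available almost everywhere. *)
Definition regular_point z := cintegrable mu (fun p => (z - toC p)^-1) /\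
  mu [set ofC z] = 0%E.

Lemma transform1 : transform 1 = cauchy_transform mu.
Proof.
apply/funext => z; rewrite /transform; apply: eq_cint => p.
by rewrite hornerC mul1r.
Qed.

Lemma cintegrable_transform g z : regular_point z ->
  cintegrable mu (fun p => g.[toC p] * (z - toC p)^-1).
Proof.
move=> [iz _]; have [C C0 hC] := poly_bounded g.
exact: cintegrable_mul_bounded (cmeas_poly g) C0 hC iz.
Qed.

Lemma ae_neq_regular z : regular_point z -> {ae mu, forall p, z != toC p}.
Proof.
move=> [_ z0]; exists [set ofC z]; split => //; first exact: measurable_point.
move=> p /=; apply: contra_notP => pz; apply: contra_notT pz.
by rewrite negbK => /eqP->; rewrite toCK.
Qed.

Lemma transformD g h z : regular_point z ->
  transform (g + h) z = transform g z + transform h z.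
Proof.
move=> hz; rewrite /transform -cintD; [|exact: cintegrable_transform..].
by apply: eq_cint => p; rewrite hornerD mulrDl.
Qed.

Lemma transformC c z : regular_point z ->
  transform c%:P z = c * transform 1 z.
Proof.
move=> hz; rewrite /transform -cintZ; last exact: cintegrable_transform.
by apply: eq_cint => p; rewrite !hornerC mul1r.
Qed.

(** Integrates [(p - c) / (z - p) = (z - c) / (z - p) - 1] against [g mu]. *)
Lemma transformM c g z : regular_point z ->
  transform (('X - c%:P) * g) z = (z - c) * transform g z - moment g.
Proof.
move=> hz; have ig := cintegrable_transform g hz.
rewrite /transform /moment -cintZ// -cintB; [|exact: cintegrableZ|exact: cintegrable_poly].
apply: ae_eq_cint.
- exact: cintegrable_cmeas (cintegrable_transform _ hz).
- by apply: (@cintegrable_cmeas _ _ _ mu); apply: cintegrableB;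
    [exact: cintegrableZ|exact: cintegrable_poly].
apply: filterS (ae_neq_regular hz) => p zp.
have : z - toC p != 0 by rewrite subr_eq0.
rewrite hornerM hornerXsubC; move: (toC p) (g.[_]) => q v zq.
by field.
Qed.

Lemma transformX g z : regular_point z ->
  transform (g * 'X) z = z * transform g z - moment g.
Proof.
by move=> hz; rewrite mulrC -['X]subr0 -[0]polyC0 transformM// subr0.
Qed.

Lemma momentZ c g : moment (c *: g) = c * moment g.
Proof.
rewrite /moment -cintZ; last exact: cintegrable_poly.
by apply: eq_cint => p; rewrite hornerZ.
Qed.

Lemma moment0 : moment 0 = 0.
Proof. by rewrite -(scale0r 0) momentZ mul0r. Qed.

Lemma moment1 : moment 1 = ((mass)%:C)%C.
Proof.
rewrite /moment -[RHS]mul1r -/(1%:C)%C.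
have -> : (fun p : R * R => (1 : {poly R[i]}).[toC p]) = fun p => ((1 : R)%:C)%C.
  by apply/funext => p; rewrite hornerC.
by rewrite cint_real Rintegral_cst// mul1r mul1r.
Qed.

Lemma regular_far z (d : R) : 0 < d -> (forall p, K p -> d <= cmod (z - toC p)) ->
  regular_point z.
Proof.
move=> d0 hd; split.
  apply: (@cintegrable_bounded _ d^-1); rewrite ?invr_ge0 ?ltW//.
    apply: cmeasV; apply: cmeasD; first exact: cmeas_cst.
    by apply: cmeasN; exact: cmeas_toC.
  by move=> p Kp; rewrite cmodV lef_pV2 ?posrE ?hd// (lt_le_trans d0)// hd.
apply/eqP; rewrite -measure_le0 -muK le_measure ?inE//.
- exact: measurable_point.
- exact: measurableC.
- move=> p ->; rewrite /= => /hd; rewrite ofCK subrr cmod0.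
  by rewrite leNgt d0.
Qed.

Lemma cmod_transform_le g z (d C : R) : 0 < d -> 0 <= C ->
  (forall p, K p -> d <= cmod (z - toC p)) ->
  (forall p, K p -> cmod g.[toC p] <= C) ->
  cmod (transform g z) <= C / d * mass.
Proof.
move=> d0 C0 hd hC; apply: cmod_cint_bounded.
- exact: cintegrable_cmeas (cintegrable_transform g (regular_far d0 hd)).
- by rewrite divr_ge0// ltW.
- move=> p Kp; rewrite cmodM cmodV ler_pM ?cmod_ge0 ?invr_ge0 ?cmod_ge0 ?hC//.
  by rewrite lef_pV2 ?posrE ?hd// (lt_le_trans d0)// hd.
Qed.

Lemma far_dist z p : B < cmod z -> K p -> cmod z - B <= cmod (z - toC p).
Proof.
move=> Bz /KB pB; rewrite (le_trans _ (cmod_ge_sub _ _))//.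
by rewrite lerB.
Qed.

Lemma regular_infinity z : B < cmod z -> regular_point z.
Proof.
move=> Bz; apply: (@regular_far _ (cmod z - B)); first by rewrite subr_gt0.
by move=> p; exact: far_dist.
Qed.

Lemma transform_vanishes g : vanishes_at_infinity (transform g).
Proof.
move=> e e0; have [C C0 hC] := poly_bounded g.
exists (B + (C * mass + 1) / e) => z hz.
have k0 : 0 < (C * mass + 1) / e.
  by rewrite divr_gt0// ltr_wpDl// mulr_ge0// mass_ge0.
have Bz : B < cmod z by rewrite (lt_trans _ hz)// ltrDl.
have d0 : 0 < cmod z - B by rewrite subr_gt0.
apply: le_trans (cmod_transform_le d0 C0 (fun p => @far_dist z p Bz) hC) _.
rewrite mulrAC ler_pdivrMr//.
move: hz; rewrite -ltrBrDl ltr_pdivrMr// => /ltW h.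
by rewrite [leRHS]mulrC (le_trans _ h)// lerDl.
Qed.

(** The polynomial is [int (g(z) - g(p)) / (z - p) dmu(p)], built here by Horner's scheme. Its size
    bound later yields that [N / Q] is a proper fraction. *)
Lemma transform_polynomial_part (g : {poly R[i]}) : exists2 P0 : {poly R[i]},
  (size P0 <= (size g).-1)%N &
  forall z, regular_point z -> transform g z = g.[z] * transform 1 z - P0.[z].
Proof.
elim/poly_ind: g => [|g c [P0 sP0 IH]].
  exists 0; first by rewrite size_poly0.
  move=> z hz; rewrite !horner0 subr0 mul0r -polyC0 transformC// mul0r//.
exists (P0 * 'X + (moment g)%:P).
  have [g0|g0] := eqVneq g 0.
    move: sP0; rewrite g0 size_poly0 leqn0 size_poly_eq0 => /eqP ->.
    by rewrite moment0 !mul0r add0r size_poly0.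
  rewrite !size_MXaddC (negbTE g0)/=; case: ifP => // _ /=.
  by rewrite (leq_ltn_trans sP0)// prednK// size_poly_gt0.
move=> z hz; rewrite transformD// transformX// transformC// IH//.
by rewrite !hornerMXaddC; ring.
Qed.

Lemma transformZ c g z : regular_point z ->
  transform (c *: g) z = c * transform g z.
Proof.
move=> hz; rewrite /transform -cintZ; last exact: cintegrable_transform.
by apply: eq_cint => p; rewrite hornerZ mulrA.
Qed.

(** The moment is the coefficient of [1 / z] at infinity: by [transformX] it is minus the transform
    of [h * 'X] far away, and that transform vanishes at infinity. *)
Lemma moment_eq0 h (r : R) : (forall z, r < cmod z -> transform h z = 0) ->
  moment h = 0.
Proof.
move=> hr; apply: vanishes_at_infinity_cst => e e0.
have [s hs] := transform_vanishes (h * 'X) e0.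
exists (Num.max (Num.max r s) B) => z; rewrite !gt_max => /andP[/andP[rz sz] Bz].
have := transformX h (regular_infinity Bz); rewrite hr// mulr0 sub0r => hX.
by rewrite -[moment h]opprK -hX cmodN; exact: hs.
Qed.

Variables Q N : {poly R[i]}.
Hypothesis Q_neq0 : Q != 0.
Hypothesis germ : same_germ_at_infinity (cauchy_transform mu) (ratfun N Q).

Let far_cauchy : exists r : R, forall z, r < cmod z ->
  Q.[z] * transform 1 z = N.[z].
Proof.
have [r hr] := germ; have [s hs] := horner_neq0_far Q_neq0.
exists (Num.max r s) => z; rewrite gt_max => /andP[/hr + /hs Qz].
by rewrite transform1 => ->; rewrite /ratfun mulrC divfK.
Qed.

(* The polynomial part of Q C_mu is read off at infinity, where Q C_mu = N and
   the Cauchy transform of Q mu tends to 0. *)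
Lemma transform_denominator : (size N <= (size Q).-1)%N /\
  forall z, regular_point z -> transform Q z = Q.[z] * transform 1 z - N.[z].
Proof.
have [P0 sP0 hP0] := transform_polynomial_part Q.
suff -> : N = P0 by [].
apply/eqP; rewrite -subr_eq0; apply/eqP/poly_vanishes_at_infinity => e e0.
have [r hr] := far_cauchy; have [s hs] := transform_vanishes Q e0.
exists (Num.max (Num.max r s) B) => z; rewrite !gt_max => /andP[/andP[rz sz] Bz].
have := hs z sz; rewrite hP0; last exact: regular_infinity.
by rewrite hr// hornerD hornerN.
Qed.

Lemma transform_denominator_far : exists r : R, forall z, r < cmod z ->
  transform Q z = 0.
Proof.
have [_ h] := transform_denominator; have [r hr] := far_cauchy.
exists (Num.max r B) => z; rewrite gt_max => /andP[rz Bz].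
by rewrite h ?hr ?subrr//; exact: regular_infinity.
Qed.

Lemma moment_multiple g : moment (g * Q) = 0.
Proof.
have [r0 hr0] := transform_denominator_far.
pose r := Num.max r0 B.
(* The induction is on the stronger claim that the transform of [g * Q] is 0 beyond [r]. That claim
   also kills the moment which [transformX] subtracts. *)
apply: (@moment_eq0 _ r); elim/poly_ind: g => [|g c IH] z rz;
  move: (rz); rewrite gt_max => /andP[/hr0 Qz /regular_infinity hz].
  by rewrite mul0r -(scale0r Q) transformZ// mul0r.
have -> : (g * 'X + c%:P) * Q = (g * Q) * 'X + c *: Q.
  by rewrite mulrDl mul_polyC mulrAC.
rewrite transformD// transformX// transformZ// Qz mulr0 addr0 IH// mulr0 sub0r.
by rewrite (moment_eq0 IH) oppr0.
Qed.

(** As the moments of [Q mu] all vanish, [transformX] loses its correction term. *)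
Lemma transform_multiple g z : regular_point z ->
  transform (g * Q) z = g.[z] * transform Q z.
Proof.
move=> hz; elim/poly_ind: g => [|g c IH].
  by rewrite horner0 !mul0r -(scale0r Q) transformZ// mul0r.
have -> : (g * 'X + c%:P) * Q = (g * Q) * 'X + c *: Q.
  by rewrite mulrDl mul_polyC mulrAC.
rewrite transformD// transformX// transformZ// moment_multiple subr0 IH.
by rewrite hornerMXaddC; ring.
Qed.

(** Expanding the transform of [Q] in two ways, through [Q'] and directly, gives
    [N = (X - z0) P0 + moment Q'] near infinity, hence as polynomials. Thus [int Q' dmu] is the same
    for all representing measures. *)
Lemma numerator_at_root Q' z0 : Q = ('X - z0%:P) * Q' -> N.[z0] = moment Q'.
Proof.
move=> QE; have [P0 _ hP0] := transform_polynomial_part Q'.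
have [_ hQ] := transform_denominator.
suff : N - ('X - z0%:P) * P0 - (moment Q')%:P = 0.
  move=> /(congr1 (horner^~ z0)).
  by rewrite !hornerE subrr mul0r subr0 => /eqP; rewrite subr_eq0 => /eqP.
apply: (@vanishes_near_infinity_poly _ _ B) => z Bz.
have hz := regular_infinity Bz.
have := hQ z hz; rewrite QE transformM// hP0// !hornerE.
move: (transform 1 z) (Q'.[z]) (P0.[z]) (N.[z]) (moment Q') => t q u n m h.
have -> : n - (z - z0) * u - m = (z - z0) * q * t - ((z - z0) * q * t - n) -
  (z - z0) * u - m by ring.
by rewrite -h; ring.
Qed.

Hypotheses (cK : compact K) (xK : convex_set K).

Lemma regular_outside z : ~ K (ofC z) -> regular_point z.
Proof.
move=> zK; have [c [r [r0 hr rz]]] := convex_compact_disc cK xK zK.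
apply: (@regular_far _ (cmod (z - c) - r)); first by rewrite subr_gt0.
move=> p Kp; have -> : z - toC p = (z - c) - (toC p - c) by ring.
by rewrite (le_trans _ (cmod_ge_sub _ _))// lerB// hr.
Qed.

(* Multiplying Q by (X - c)^n multiplies the transform at z by (z - c)^n, but
   if a disc centred at c contains K and not z then it cannot grow so fast. *)
Lemma transform_denominator_outside z : ~ K (ofC z) -> transform Q z = 0.
Proof.
move=> zK; have [c [r [r0 hr rz]]] := convex_compact_disc cK xK zK.
have hz := regular_outside zK.
have zc0 := le_lt_trans r0 rz.
pose d := cmod (z - c) - r; have d0 : 0 < d by rewrite subr_gt0.
have hd p : K p -> d <= cmod (z - toC p).
  move=> Kp; have -> : z - toC p = (z - c) - (toC p - c) by ring.
  by rewrite (le_trans _ (cmod_ge_sub _ _))// lerB// hr.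
have [C C0 hC] := poly_bounded Q.
have bound n : cmod (transform Q z) <= C / d * mass * (r / cmod (z - c)) ^+ n.
  have h p : K p -> cmod ((('X - c%:P) ^+ n * Q).[toC p]) <= r ^+ n * C.
    move=> Kp; rewrite hornerM horner_exp hornerXsubC cmodM cmodX.
    by rewrite ler_pM ?exprn_ge0 ?cmod_ge0 ?hC// lerXn2r ?nnegrE ?cmod_ge0 ?hr.
  have := cmod_transform_le d0 (mulr_ge0 (exprn_ge0 n r0) C0) hd h.
  rewrite transform_multiple// horner_exp hornerXsubC cmodM cmodX.
  rewrite expr_div_n [X in _ -> _ <= X]mulrA ler_pdivlMr ?exprn_gt0//.
  rewrite [_ ^+ n * cmod _]mulrC => /le_trans; apply.
  by rewrite le_eqVlt; apply/predU1P; left; ring.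
apply/eqP; rewrite -cmod_eq0 eq_le cmod_ge0 andbT.
have q1 : `|r / cmod (z - c)| < 1.
  by rewrite ger0_norm ?divr_ge0 ?cmod_ge0// ltr_pdivrMr// mul1r.
have lim : (fun n => C / d * mass * (r / cmod (z - c)) ^+ n) @ \oo -->
    (C / d * mass * 0).
  by apply: cvgM; [exact: cvg_cst|exact: cvg_expr].
rewrite mulr0 in lim.
by apply: (cvgr_to_ge lim); apply: nearW => n; exact: bound.
Qed.

Hypothesis coprime_QN : coprimep Q N.

Lemma coprime_numerator_neq0 z0 : root Q z0 -> N.[z0] != 0.
Proof. by move=> Qz; exact: coprimep_root coprime_QN Qz. Qed.

(** At a root [z0] outside [K], [transformM] with [c = z0] makes the transform of [Q] equal to
    [- moment Q' = - N(z0)]. This is nonzero by coprimality, yet the transform vanishes off [K]. *)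
Lemma root_in_support z0 : root Q z0 -> K (ofC z0).
Proof.
move=> Qz; apply: contrapT => zK; have hz := regular_outside zK.
have [Q' QE] := factor_theorem _ _ Qz; rewrite mulrC in QE.
have := transform_denominator_outside zK.
rewrite QE transformM// subrr mul0r sub0r -(numerator_at_root QE) => /eqP.
by rewrite oppr_eq0 (negbTE (coprime_numerator_neq0 Qz)).
Qed.

End supported_measure.

Lemma area_point (R : realType) (p : R * R) : @area R [set p] = 0%E.
Proof.
have -> : [set p] = [set p.1] `*` [set p.2].
  by apply/seteqP; split; case: p => [a b] [c e] /= [-> ->].
by rewrite area_setX// leb_set1 mul0e.
Qed.

(** * Joint integrability of the Cauchy kernel for area and [mu] *)

Section cauchy_transform_fubini.
Context {R : realType}.
Variable mu : {finite_measure set (R * R)%type -> \bar R}.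
Implicit Types (L M S C : R) (psi : R -> R).

Let box L M : set (R * R) := `[- M, M]%classic `*` `[- L, L]%classic.

Lemma integrable_kernel_prod L M : 0 <= L -> 0 <= M ->
  (@area R \x mu)%E.-integrable setT
    (EFin \o (fun u => \1_(box L M) u.1 * kernel_bound u.1 u.2)).
Proof.
move=> L0 M0; have mb : measurable (box L M) by exact: measurableX.
have mg : measurable_fun setT (EFin \o (fun u : (R * R) * (R * R) =>
    \1_(box L M) u.1 * kernel_bound u.1 u.2)).
  apply/measurable_EFinP; apply: measurable_funM.
    by apply: measurableT_comp measurable_fst; exact: measurable_indic.
  exact: measurable_kernel_bound2.
have g0 u : 0 <= \1_(box L M) u.1 * kernel_bound u.1 u.2.
  by rewrite mulr_ge0// kernel_bound_ge0.
apply/(integrable21ltyP (@area R) mu mg).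
pose k := (M - (- M) + (L - (- L))) * pi.
apply: (@le_lt_trans _ _ (\int[mu]_(p in setT) (cst k%:E p))%E); last first.
  by rewrite integral_cst// lte_mul_pinfty ?lee_fin// ?ltey_eq ?fin_num_measure//
    /k mulr_ge0 ?pi_ge0//; lra.
apply: ge0_le_integral => //=.
- by move=> p _; apply: integral_ge0.
- apply: (measurable_fun_fubini_tonelli_G (abse \o (EFin \o (fun u : (R * R) * (R * R) =>
    \1_(box L M) u.1 * kernel_bound u.1 u.2)))) => //=.
  exact: measurableT_comp.
move=> p _; apply: le_trans (integral_kernel_bound_le p _ _); [|lra|lra].
rewrite [leRHS]integral_mkcond le_eqVlt; apply/predU1P; left.
apply: eq_integral => z _; rewrite ger0_norm; last exact: (g0 (z, p)).
rewrite patchE indicE.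
by case: ifP => _; rewrite ?mul1r ?mul0r.
Qed.

Lemma cintegrable_kernel_prod L M psi S (h : R * R -> R[i]) C :
  0 <= L -> 0 <= M -> continuous psi ->
  (forall y, `|y| <= L -> `|psi y| <= S) ->
  cmeas h -> (forall p, cmod (h p) <= C) ->
  cintegrable (@area R \x mu)%E (fun u =>
    ((box_weight L M psi u.1)%:C)%C * (h u.2 * (toC u.1 - toC u.2)^-1)).
Proof.
move=> L0 M0 cpsi hS mh hC.
apply: (cintegrable_le _ (integrableZl measurableT (S * C)
  (integrable_kernel_prod L0 M0))).
  apply: cmeasM.
    apply: cmeas_real; apply: measurableT_comp measurable_fst.
    exact: measurable_box_weight.
  have [h1 h2] := mh; have [c1 c2] := @cmeas_toC R.
  have m1 : cmeas (fun u : (R * R) * (R * R) => h u.2).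
    by split; [exact: (measurableT_comp h1 measurable_snd)|
      exact: (measurableT_comp h2 measurable_snd)].
  have m2 : cmeas (fun u : (R * R) * (R * R) => toC u.1).
    by split; [exact: (measurableT_comp c1 measurable_fst)|
      exact: (measurableT_comp c2 measurable_fst)].
  have m3 : cmeas (fun u : (R * R) * (R * R) => toC u.2).
    by split; [exact: (measurableT_comp c1 measurable_snd)|
      exact: (measurableT_comp c2 measurable_snd)].
  apply: cmeasM => //; apply: cmeasV; apply: cmeasD => //; exact: cmeasN.
move=> u; rewrite mulrCA cmodM mulrAC mulrC ler_pM ?cmod_ge0//.
exact: cmod_box_kernel_le.
Qed.

(** The diagonal is null for the product of area and [mu], because points have area 0; slicing it
    the other way gives [mu [set z]]. *)
Lemma ae_not_atom : {ae @area R, forall z, mu [set z] = 0%E}.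
Proof.
(* The indicator of the diagonal, written by coordinate differences so that its measurability is
   immediate. *)
pose d (u : (R * R) * (R * R)) : R :=
  \1_[set 0 : R] (u.1.1 - u.2.1) * \1_[set 0 : R] (u.1.2 - u.2.2).
have md : measurable_fun setT (EFin \o d).
  apply/measurable_EFinP; apply: measurable_funM;
    (apply: measurableT_comp; first exact: measurable_indic);
    apply: measurable_funB.
  - by apply: measurableT_comp measurable_fst _; exact: measurable_fst.
  - by apply: measurableT_comp measurable_fst _; exact: measurable_snd.
  - by apply: measurableT_comp measurable_snd _; exact: measurable_fst.
  - by apply: measurableT_comp measurable_snd _; exact: measurable_snd.
have dE z p : d (z, p) = \1_[set z] p /\ d (z, p) = \1_[set p] z.
  have i1 (T : eqType) (x y : T) : \1_[set y] x = (x == y)%:R :> R.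
    by rewrite indicE; congr (nat_of_bool _)%:R; apply/idP/eqP; rewrite inE.
  rewrite /d !i1 !subr_eq0 -natrM mulnb [z == p]eq_sym.
  by case: z p => [a b] [c e] /=; rewrite xpair_eqE [c == a]eq_sym [e == b]eq_sym.
have d0 u : (0 <= (EFin \o d) u)%E by rewrite lee_fin mulr_ge0.
have := fubini_tonelli (m1 := @area R) (m2 := mu) (EFin \o d) md d0.
have -> : (\int[mu]_y \int[@area R]_x (EFin \o d) (x, y) = 0)%E.
  apply: integral0_eq => p _.
  under eq_integral do rewrite /= (dE _ _).2.
  rewrite integral_indic//; last exact: measurable_point.
  by rewrite setIT; exact: area_point.
move=> hfub; have h z : (\int[mu]_p (EFin \o d) (z, p) = mu [set z])%E.
  under eq_integral do rewrite /= (dE _ _).1.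
  by rewrite integral_indic// ?setIT//; exact: measurable_point.
have mh : measurable_fun setT (fun z => mu [set z]).
  rewrite (_ : (fun z => _) = fubini_F mu (EFin \o d)).
    exact: measurable_fun_fubini_tonelli_F.
  by apply/funext => z; rewrite -h.
have eh : (\int[@area R]_x `|mu [set x]| = 0)%E.
  rewrite -[RHS]hfub; apply: eq_integral => z _.
  by rewrite h gee0_abs.
have := (ae_eq_integral_abs (@area R) measurableT mh).1 eh.
by apply: filterS => z; exact.
Qed.

(** Positive and negative parts are handled separately by Tonelli's theorem, which covers the points
    [z] where the kernel is not integrable. *)
Lemma cmeas_cauchy_transform : cmeas (fun z => cauchy_transform mu (toC z)).
Proof.
have main (f : (R * R) * (R * R) -> R) : measurable_fun setT f ->
    measurable_fun setT (fun z => \int[mu]_(p in setT) f (z, p))%R.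
  move=> mf; apply: measurableT_comp => //.
  have me : measurable_fun setT (EFin \o f) by exact/measurable_EFinP.
  under eq_fun do rewrite integralE.
  apply: emeasurable_funB.
  - have h : measurable_fun setT (fubini_F mu ((EFin \o f)^\+)%E).
      apply: measurable_fun_fubini_tonelli_F; first exact: measurable_funepos.
      by move=> u; exact: funepos_ge0.
    rewrite [X in measurable_fun _ X](_ : _ = fubini_F mu ((EFin \o f)^\+)%E).
      exact: h.
    by apply/funext => x; apply: eq_integral => y _; rewrite /fubini_F !funeposE.
  - have h : measurable_fun setT (fubini_F mu ((EFin \o f)^\-)%E).
      apply: measurable_fun_fubini_tonelli_F; first exact: measurable_funeneg.
      by move=> u; exact: funeneg_ge0.
    rewrite [X in measurable_fun _ X](_ : _ = fubini_F mu ((EFin \o f)^\-)%E).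
      exact: h.
    by apply/funext => x; apply: eq_integral => y _; rewrite /fubini_F !funenegE.
have [c1 c2] := @cmeas_toC R.
have [k1 k2] : cmeas (fun u : (R * R) * (R * R) => (toC u.1 - toC u.2)^-1).
  apply: cmeasV; apply: cmeasD; last apply: cmeasN.
    by split; [exact: (measurableT_comp c1 measurable_fst)|
      exact: (measurableT_comp c2 measurable_fst)].
  by split; [exact: (measurableT_comp c1 measurable_snd)|
    exact: (measurableT_comp c2 measurable_snd)].
by split; [exact: (main _ k1)|exact: (main _ k2)].
Qed.

End cauchy_transform_fubini.

(** * Integrals of [Psi(Im p) g(p) Q(p)] bounded by the deviation *)

Section test_functions.
Context {R : realType}.
Variables (K : set (R * R)) (Q N : {poly R[i]}).
Hypotheses (cK : compact K) (xK : convex_set K) (Q_neq0 : Q != 0).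

Let mK : measurable K := compact_measurable2 cK.

Section fixed_measure.
Variable mu : {finite_measure set (R * R)%type -> \bar R}.
Hypotheses (muK : mu (~` K) = 0%E)
  (germ : same_germ_at_infinity (cauchy_transform mu) (ratfun N Q)).

(** Fubini's theorem with [psi = 1] and [h = 1] makes the kernel integrable for almost every [z] of
    the box, where the weight is 1; [ae_not_atom] gives the other half. *)
Lemma ae_regular_box (L M : R) : 0 <= L -> 0 <= M ->
  {ae @area R, forall z,
    (`[- M, M]%classic `*` `[- L, L]%classic) z -> regular_point mu (toC z)}.
Proof.
move=> L0 M0.
have c1 : forall y : R, `|y| <= L -> `|cst 1 y| <= 1 :> R by move=> y _; rewrite normr1.
have h1 (p : R * R) : cmod (1 : R[i]) <= 1 by rewrite cmod1.
have i := cintegrable_kernel_prod mu L0 M0 (@cst_continuous R R 1) c1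
  (@cmeas_cst _ (R * R)%type R 1) h1.
apply: filterS2 (ae_cintegrable1 i) (ae_not_atom mu) => z iz z0 zB.
split; last by rewrite toCK.
have -> : (fun p => (toC z - toC p)^-1) = fun p => ((box_weight L M (cst 1) z)%:C)%C *
    (1 * (toC z - toC p)^-1).
  by apply/funext => p; rewrite /box_weight indicE mem_set//= !mul1r.
exact: iz.
Qed.

Lemma transform_multiple_le (g : {poly R[i]}) (C : R) z : 0 <= C ->
  (forall p, K p -> cmod g.[toC p] <= C) -> regular_point mu (toC z) ->
  cmod (transform mu (g * Q) (toC z)) <=
  C * (\1_K z * cmod (Q.[toC z] * cauchy_transform mu (toC z) - N.[toC z])).
Proof.
move=> C0 hC hz; have [B _ KB] := compact_cmod_bounded cK.
have [_ hQ] := transform_denominator mK muK KB Q_neq0 germ.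
rewrite (transform_multiple mK muK KB Q_neq0 germ)// cmodM.
have [Kz|Kz] := pselect (K z).
  rewrite indicE mem_set// mul1r hQ// transform1.
  by rewrite ler_wpM2r ?cmod_ge0// hC.
rewrite (transform_denominator_outside mK muK KB Q_neq0 germ cK xK); last by rewrite toCK.
by rewrite cmod0 mulr0 !mulr_ge0// cmod_ge0.
Qed.

Lemma measurable_deviation_integrand : measurable_fun setT (fun z : R * R =>
  cmod (Q.[toC z] * cauchy_transform mu (toC z) - N.[toC z])).
Proof.
apply: (measurable_cmod (F := fun z : R * R =>
  Q.[toC z] * cauchy_transform mu (toC z) - N.[toC z])).
apply: cmeasD; last by apply: cmeasN; exact: cmeas_poly.
by apply: cmeasM; [exact: cmeas_poly|exact: cmeas_cauchy_transform].
Qed.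

Lemma deviation_ge0 : (0 <= deviation Q N K mu)%E.
Proof. by apply: integral_ge0 => z _; rewrite lee_fin cmod_ge0. Qed.

(* Fubini's theorem for h(p) / (z - p) on the product of area and mu: inside,
   the integral in p is the transform of g Q, which vanishes off K; the
   integral in z is 2 pi i Psi(Im p) up to a constant and a small error. *)
Lemma level_function_bound_fixed (g : {poly R[i]}) (psi Psi : R -> R)
    (L Sp Sg : R) :
  0 < L -> (forall p, K p -> cmod (toC p) <= L) ->
  continuous psi -> (forall x : R, is_derive x 1 Psi (psi x)) ->
  0 <= Sp -> (forall y, `|y| <= L -> `|psi y| <= Sp) ->
  0 <= Sg -> (forall p, K p -> cmod g.[toC p] <= Sg) ->
  ((2 * pi * cmod (cint mu (fun p => ((Psi p.2)%:C)%C * (g * Q).[toC p])))%:E <=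
   (Sp * Sg)%:E * deviation Q N K mu)%E.
Proof.
move=> L0 KL cpsi dPsi Sp0 hSp Sg0 hSg; set J := cint mu _.
have cPsi : continuous Psi.
  move=> x; apply: differentiable_continuous; apply/derivable1_diffP.
  by have [] := dPsi x.
have [C C0 hC] := poly_bounded KL (g * Q).
apply/lee_addgt0Pr => e e0.
pose k := C * mass mu + 1.
have k0 : 0 < k by rewrite ltr_wpDl// mulr_ge0// mass_ge0.
have [M LM hM] := box_kernel_limit L0 cpsi dPsi (divr_gt0 e0 k0).
have M0 : 0 <= M by lra.
(* A polynomial is bounded on [K] only, and the product integrability needs a global bound. *)
pose h p := ((\1_K p)%:C)%C * (g * Q).[toC p].
have mh : cmeas h by apply: (cmeas_cutoff mK); exact: cmeas_poly.
have hCh p : cmod (h p) <= C.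
  by apply: (@cmod_cutoff_le _ _ (fun q => (g * Q).[toC q])) => // Kp; exact: hC.
pose F (u : (R * R) * (R * R)) := ((box_weight L M psi u.1)%:C)%C *
  (h u.2 * (toC u.1 - toC u.2)^-1).
have iF : cintegrable (@area R \x mu)%E F.
  exact: (cintegrable_kernel_prod mu (ltW L0) M0 cpsi hSp mh hCh).
have fub := etrans (cint_prod1 iF) (esym (cint_prod2 iF)).
have iH := cintegrable_cint1 iF; have iG := cintegrable_cint2 iF.
set H := (fun z => cint mu (fun p => F (z, p))) in fub iH.
set G := (fun p => cint (@area R) (fun z => F (z, p))) in fub iG.
have HE z : regular_point mu (toC z) ->
    H z = ((box_weight L M psi z)%:C)%C * transform mu (g * Q) (toC z).
  move=> hz; have iz := cintegrable_transform mK muK KL (g * Q) hz.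
  have mz : cmeas (fun p => h p * (toC z - toC p)^-1).
    apply: (cmeasM mh); exact: (cintegrable_cmeas (proj1 hz)).
  have ez : {ae mu, forall p, (g * Q).[toC p] * (toC z - toC p)^-1 =
      h p * (toC z - toC p)^-1}.
    by apply: filterS (cutoff_ae mK muK (fun p => (g * Q).[toC p])) => p ->.
  rewrite /H /F /= cintZ; last exact: (ae_eq_cintegrable mz ez iz).
  by rewrite /transform (ae_eq_cint (cintegrable_cmeas iz) mz ez).
have H0 z : ~ (`[- M, M]%classic `*` `[- L, L]%classic) z -> H z = 0.
  move=> zB; rewrite /H /F /= /box_weight indicE memNset// mul0r.
  transitivity (cint mu (fun=> ((0 : R)%:C)%C)).
    by apply: eq_cint => p; rewrite mul0r.
  by rewrite cint_real Rintegral_cst// mul0r.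
have boundH : ((cmod (cint (@area R) H))%:E <= (Sp * Sg)%:E * deviation Q N K mu)%E.
  have iHn := cintegrable_cmod iH.
  apply: (@le_trans _ _ (\int[@area R]_(z in setT) (cmod (H z))%:E)%E).
    rewrite -(fineK (integrable_fin_num measurableT iHn)) lee_fin.
    exact: cmod_cint_le.
  pose D z := cmod (Q.[toC z] * cauchy_transform mu (toC z) - N.[toC z]).
  have mD := measurable_deviation_integrand.
  apply: (@le_trans _ _ (\int[@area R]_(z in setT) (Sp * Sg * (\1_K z * D z))%:E)%E).
    apply: ae_ge0_le_integral => //.
    - by move=> z _; rewrite lee_fin cmod_ge0.
    - exact: measurable_int iHn.
    - by move=> z _; rewrite lee_fin !mulr_ge0// cmod_ge0.
    - apply/measurable_EFinP; apply: measurable_funM => //.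
      by apply: measurable_funM => //; exact: measurable_indic.
    apply: filterS (ae_regular_box (ltW L0) M0) => z hz _; rewrite lee_fin.
    have [zB|zB] := pselect ((`[- M, M]%classic `*` `[- L, L]%classic) z); last first.
      by rewrite H0// cmod0 !mulr_ge0// cmod_ge0.
    rewrite HE; last exact: hz.
    rewrite cmodM cmod_real -mulrA ler_pM ?cmod_ge0//.
      rewrite /box_weight indicE mem_set// mul1r hSp//.
      by case: zB => _ /=; rewrite in_itv/= ler_norml.
    by apply: transform_multiple_le => //; exact: hz.
  rewrite /deviation -ge0_integralZl//; last 3 first.
  - by apply: measurable_funTS; exact/measurable_EFinP.
  - by move=> z _; rewrite lee_fin cmod_ge0.
  - by rewrite lee_fin mulr_ge0.
  rewrite [leRHS]integral_mkcond le_eqVlt; apply/predU1P; left.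
  apply: eq_integral => z _; rewrite patchE indicE.
  by case: ifP => _; rewrite ?mul1r ?mul0r ?mulr0.
(* The part of the limit that does not depend on [p]: it multiplies [int g Q dmu], which is 0 by
   [moment_multiple]. *)
pose c0 := Psi L + Psi (- L).
pose V (p : R * R) := Complex 0 (- pi * (c0 - 2 * Psi p.2)).
have VE p : (g * Q).[toC p] * V p =
    Complex 0 (2 * pi) * (((Psi p.2)%:C)%C * (g * Q).[toC p]) +
    Complex 0 (- pi * c0) * (g * Q).[toC p].
  rewrite /V; case: ((g * Q).[_]) => a b; apply/eqP; rewrite eq_complex /=.
  by apply/andP; split; apply/eqP; ring.
have igQ := cintegrable_poly mK muK KL (g * Q).
have iJ : cintegrable mu (fun p => ((Psi p.2)%:C)%C * (g * Q).[toC p]).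
  have [S S0 hS] := continuous_bounded_itv (ltW L0) cPsi.
  apply: (cintegrable_mul_bounded mK muK _ S0 _ igQ).
    apply: cmeas_real; apply: measurableT_comp measurable_snd.
    exact: continuous_measurable_fun.
  move=> p Kp; rewrite cmod_real hS//.
  by rewrite (le_trans (normr_Im_le (toC p)))// KL.
have iV : cintegrable mu (fun p => (g * Q).[toC p] * V p).
  under eq_fun do rewrite VE.
  by apply: cintegrableD; exact: cintegrableZ.
have cV : cint mu (fun p => (g * Q).[toC p] * V p) = Complex 0 (2 * pi) * J.
  under eq_cint do rewrite VE.
  rewrite cintD; [|exact: cintegrableZ|exact: cintegrableZ].
  rewrite !cintZ// -/(moment mu (g * Q)).
  by rewrite (moment_multiple mK muK KL Q_neq0 germ) mulr0 addr0.
have diff : cmod (cint mu G - Complex 0 (2 * pi) * J) <= e.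
  rewrite -cV -cintB//.
  apply: (@le_trans _ _ (C * (e / k) * mass mu)).
    apply: (cmod_cint_bounded mK muK).
    - exact: cintegrable_cmeas (cintegrableB iG iV).
    - by rewrite mulr_ge0// divr_ge0// ltW.
    move=> p Kp.
    have -> : G p = (g * Q).[toC p] * cint (@area R) (fun z =>
        ((box_weight L M psi z)%:C)%C * (toC z - toC p)^-1).
      rewrite -cintZ.
        by apply: eq_cint => z; rewrite /F /h /= indicE mem_set// mul1r mulrCA.
      exact: (cintegrable_box_kernel p (ltW L0) M0 cpsi hSp).
    rewrite -mulrBr cmodM ler_pM ?cmod_ge0 ?hC//.
    apply: hM.
      by rewrite (le_trans (normr_Re_le (toC p)))// KL.
    by rewrite (le_trans (normr_Im_le (toC p)))// KL.
  rewrite mulrAC -[leRHS](divfK (lt0r_neq0 k0)) mulrC ler_wpM2l//.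
    by rewrite divr_ge0// ltW.
  by rewrite /k lerDl.
have -> : 2 * pi * cmod J = cmod (Complex 0 (2 * pi) * J).
  rewrite cmodM; congr (_ * _).
  by rewrite /cmod /= expr0n add0r sqrtr_sqr ger0_norm// mulr_ge0// pi_ge0.
apply: (@le_trans _ _ ((cmod (cint mu G))%:E + e%:E)%E).
  rewrite -EFinD lee_fin -lerBlDl.
  by rewrite (le_trans (cmod_ge_sub _ _))// cmod_distC.
by rewrite -fub leeD.
Qed.

End fixed_measure.

Lemma level_function_bound (g : {poly R[i]}) (psi Psi : R -> R) :
  continuous psi -> (forall x : R, is_derive x 1 Psi (psi x)) ->
  exists2 S : R, 0 <= S & forall mu, representing_measures (ratfun N Q) K mu ->
  ((cmod (cint mu (fun p => ((Psi p.2)%:C)%C * (g * Q).[toC p])))%:E <=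
   S%:E * deviation Q N K mu)%E.
Proof.
move=> cpsi dPsi; have [B B0 KB] := compact_cmod_bounded cK.
have L0 : 0 < B + 1 by lra.
have KL p : K p -> cmod (toC p) <= B + 1.
  by move=> /KB h; rewrite (le_trans h)// lerDl.
have [Sp Sp0 hSp] := continuous_bounded_itv (ltW L0) cpsi.
have [Sg Sg0 hSg] := poly_bounded KL g.
have p0 : 0 < 2 * pi :> R by rewrite mulr_gt0// pi_gt0.
exists ((2 * pi)^-1 * (Sp * Sg)).
  by rewrite mulr_ge0 ?invr_ge0 ?(ltW p0)// mulr_ge0.
move=> mu [muK germ].
have := level_function_bound_fixed muK germ L0 KL cpsi dPsi Sp0 hSp Sg0 hSg.
rewrite EFinM [in X in _ -> X]EFinM -muleA lee_pdivlMl//.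
Qed.

End test_functions.

(** * The deviation bounds the integral of [|Q|^2], and of functions small at the roots *)

Section denominator_bound.
Context {R : realType}.
Variables (K : set (R * R)) (Q N : {poly R[i]}).
Hypotheses (cK : compact K) (xK : convex_set K) (Q_neq0 : Q != 0).

Let mK : measurable K := compact_measurable2 cK.
Let repr := representing_measures (ratfun N Q) K.

(** The constant [S] precedes [mu]. Boundedness on [K] is included so that sums and multiples remain
    integrable for every representing measure. *)
Definition controlled (phi : R * R -> R[i]) := cmeas phi /\
  (exists2 C : R, 0 <= C & forall p, K p -> cmod (phi p) <= C) /\
  exists2 S : R, 0 <= S & forall mu, repr mu ->
    ((cmod (cint mu (fun p => phi p * Q.[toC p])))%:E <=
     S%:E * deviation Q N K mu)%E.

Lemma cintegrable_controlled phi mu : repr mu -> controlled phi ->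
  cintegrable mu (fun p => phi p * Q.[toC p]).
Proof.
move=> [muK _] [mphi [[C C0 hC] _]]; have [B _ KB] := compact_cmod_bounded cK.
apply: (cintegrable_mul_bounded mK muK mphi C0 hC).
exact: (cintegrable_poly mK muK KB).
Qed.

Lemma controlledD phi chi : controlled phi -> controlled chi ->
  controlled (fun p => phi p + chi p).
Proof.
move=> cphi cchi; have [m1 [[C1 C10 h1] [S1 S10 b1]]] := cphi.
have [m2 [[C2 C20 h2] [S2 S20 b2]]] := cchi.
split; first exact: cmeasD.
split.
  exists (C1 + C2); first exact: addr_ge0.
  by move=> p Kp; rewrite (le_trans (cmodD_le _ _))// lerD ?h1 ?h2.
exists (S1 + S2); first exact: addr_ge0.
move=> mu rmu; under eq_cint do rewrite mulrDl.
rewrite cintD; [|exact: cintegrable_controlled..].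
rewrite EFinD ge0_muleDl ?lee_fin//.
apply: le_trans (leeD (b1 mu rmu) (b2 mu rmu)).
by rewrite -EFinD lee_fin cmodD_le.
Qed.

Lemma controlledZ c phi : controlled phi -> controlled (fun p => c * phi p).
Proof.
move=> cphi; have [m1 [[C1 C10 h1] [S1 S10 b1]]] := cphi.
split; first by apply: cmeasM => //; exact: cmeas_cst.
split.
  exists (cmod c * C1); first by rewrite mulr_ge0 ?cmod_ge0.
  by move=> p Kp; rewrite cmodM ler_wpM2l ?cmod_ge0 ?h1.
exists (cmod c * S1); first by rewrite mulr_ge0 ?cmod_ge0.
move=> mu rmu; under eq_cint do rewrite -mulrA.
rewrite cintZ; last exact: cintegrable_controlled.
rewrite cmodM !EFinM -muleA lee_wpmul2l ?lee_fin ?cmod_ge0//.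
exact: b1.
Qed.

(* conj p = p - 2 i Im p reduces antiholomorphic factors to powers of Im p. *)
Lemma controlled_conjc (G : {poly R[i]}) (q : {poly R}) (g : {poly R[i]}) :
  controlled (fun p => conjc G.[toC p] * ((q.[p.2])%:C)%C * g.[toC p]).
Proof.
(* Both [q] and [g] vary: a factor [conj p] is traded for a factor [p], absorbed by [g], and a
   factor [Im p], absorbed by [q]. *)
elim/poly_ind: G q g => [|G c IH] q g.
  have -> : (fun p : R * R => conjc (0 : {poly R[i]}).[toC p] * ((q.[p.2])%:C)%C *
      g.[toC p]) = fun p => 0.
    by apply/funext => p; rewrite horner0 rmorph0 !mul0r.
  split; first exact: cmeas_cst.
  split; first by exists 0 => // p _; rewrite cmod0.
  exists 0 => // mu _; rewrite mul0e lee_fin.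
  under eq_cint do rewrite mul0r -[0]/((0 : R)%:C)%C.
  by rewrite cint_real Rintegral_cst// mul0r cmod0.
have base : controlled (fun p => ((q.[p.2])%:C)%C * g.[toC p]).
  have mq : measurable_fun setT (fun p : R * R => q.[p.2]).
    apply: measurableT_comp measurable_snd.
    by apply: continuous_measurable_fun; exact: continuous_horner.
  have dq := is_derive_poly q.
  split; first by apply: cmeasM; [exact: cmeas_real|exact: cmeas_poly].
  have [B B0 KB] := compact_cmod_bounded cK.
  split.
    have [Cg Cg0 hg] := poly_bounded KB g.
    have [Cq Cq0 hq] := continuous_bounded_itv B0 (@continuous_horner R q).
    exists (Cq * Cg); first exact: mulr_ge0.
    move=> p Kp; rewrite cmodM cmod_real ler_pM ?cmod_ge0 ?hg ?hq//.
    by rewrite (le_trans (normr_Im_le (toC p)))// KB.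
  (* Here [q] is the primitive [Psi] and its derivative is the test function [psi]. *)
  have [S S0 hS] := level_function_bound N cK xK Q_neq0 g
    (@continuous_horner R q^`()) dq.
  exists S => // mu rmu.
  have -> : (fun p : R * R => ((q.[p.2])%:C)%C * g.[toC p] * Q.[toC p]) =
      fun p => ((q.[p.2])%:C)%C * (g * Q).[toC p].
    by apply/funext => p; rewrite hornerM mulrA.
  exact: hS.
have -> : (fun p : R * R => conjc (G * 'X + c%:P).[toC p] * ((q.[p.2])%:C)%C *
    g.[toC p]) = fun p =>
    (conjc G.[toC p] * ((q.[p.2])%:C)%C * (g * 'X).[toC p] +
     Complex 0 (- 2) * (conjc G.[toC p] * (((q * 'X).[p.2])%:C)%C * g.[toC p])) +
    conjc c * (((q.[p.2])%:C)%C * g.[toC p]).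
  have cD (a b : R[i]) : conjc (a + b) = conjc a + conjc b by rewrite rmorphD.
  have cM (a b : R[i]) : conjc (a * b) = conjc a * conjc b by rewrite rmorphM.
  have rM (a b : R) : ((a * b)%:C)%C = (a%:C)%C * (b%:C)%C by rewrite rmorphM.
  apply/funext => p; rewrite hornerMXaddC !hornerMX cD cM rM.
  have -> : conjc (toC p) = toC p + Complex 0 (- 2) * ((p.2)%:C)%C.
    by apply/eqP; rewrite eq_complex /=; apply/andP; split; apply/eqP; ring.
  by ring.
by apply: controlledD; [apply: controlledD => //; exact: controlledZ|exact: controlledZ].
Qed.

Lemma denominator_sqr_bound : exists2 S : R, 0 <= S & forall mu, repr mu ->
  ((\int[mu]_(p in setT) (cmod Q.[toC p] ^+ 2))%R%:E <=
   S%:E * deviation Q N K mu)%E.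
Proof.
have [_ [_ [S S0 hS]]] := controlled_conjc Q 1 1.
exists S => // mu /hS; apply: le_trans; rewrite lee_fin.
have -> : (fun p : R * R => conjc Q.[toC p] * (((1 : {poly R}).[p.2])%:C)%C *
    (1 : {poly R[i]}).[toC p] * Q.[toC p]) =
    fun p => ((cmod Q.[toC p] ^+ 2)%:C)%C.
  by apply/funext => p; rewrite !hornerC !mulr1 mul_conjc.
by rewrite cint_real cmod_real ler_norm.
Qed.

Lemma le_Rintegral_supported (mu : {finite_measure set (R * R)%type -> \bar R})
    (f g : R * R -> R) : mu (~` K) = 0%E ->
  mu.-integrable setT (EFin \o f) -> mu.-integrable setT (EFin \o g) ->
  (forall p, K p -> f p <= g p) ->
  (\int[mu]_(p in setT) f p <= \int[mu]_(p in setT) g p)%R.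
Proof.
move=> muK fi gi fg.
have cut (h : R * R -> R) : mu.-integrable setT (EFin \o h) ->
    mu.-integrable setT (EFin \o (fun p => \1_K p * h p)) /\
    (\int[mu]_(p in setT) h p = \int[mu]_(p in setT) (\1_K p * h p))%R.
  move=> hi; have mh := (measurable_EFinP _ _).1 (measurable_int _ hi).
  have mKh : measurable_fun setT (fun p => \1_K p * h p).
    by apply: measurable_funM => //; exact: measurable_indic.
  split.
    apply: le_integrable hi => //; first exact/measurable_EFinP.
    move=> p _; rewrite lee_fin normrM ler_piMl// indicE.
    by case: (_ \in _); rewrite ?normr1 ?normr0.
  apply: ae_eq_Rintegral => //.
  by apply: filterS (ae_supported mK muK) => p Kp; rewrite indicE mem_set// mul1r.
have [f1 ->] := cut f fi; have [g1 ->] := cut g gi.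
apply: le_Rintegral => // p _; rewrite indicE.
by case: (boolP (_ \in _)) => [|_]; rewrite ?mul0r// inE !mul1r; exact: fg.
Qed.

(** Rests on the pointwise bound [|phi| <= d + (C^2 / d^3) |Q|^2] on [K]. The first term integrates
    to [d] times the mass, the second is covered by [denominator_sqr_bound]. *)
Lemma small_on_zeros (phi : R * R -> R[i]) (C a0 e : R) : cmeas phi -> 0 <= C ->
  (forall p, K p -> cmod (phi p) ^+ 2 <= C * cmod Q.[toC p]) -> 0 <= a0 -> 0 < e ->
  exists2 S : R, 0 <= S & forall mu, repr mu -> mass mu = a0 ->
  ((cmod (cint mu phi))%:E <= e%:E + S%:E * deviation Q N K mu)%E.
Proof.
move=> mphi C0 hC a00 e0; have [S S0 hS] := denominator_sqr_bound.
have [B B0 KB] := compact_cmod_bounded cK.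
have [CQ CQ0 hCQ] := poly_bounded KB Q.
have phib p : K p -> cmod (phi p) <= C * CQ + 1.
  move=> Kp; have : cmod (phi p) ^+ 2 <= C * CQ.
    by rewrite (le_trans (hC p Kp))// ler_wpM2l// hCQ.
  have := sqr_ge0 (cmod (phi p) - 1); have := cmod_ge0 (phi p).
  by nra.
(* Chosen so that [d * a0 <= e]; the 1 allows [a0 = 0]. *)
pose d := e / (a0 + 1).
have d0 : 0 < d by rewrite divr_gt0// ltr_wpDl.
exists (C ^+ 2 / d ^+ 3 * S).
  by rewrite mulr_ge0// divr_ge0 ?sqr_ge0// exprn_ge0// ltW.
move=> mu rmu mass_mu; have [muK germ] := rmu.
have iphi : cintegrable mu phi.
  apply: (cintegrable_bounded mK muK mphi _ phib).
  by rewrite addr_ge0 ?mulr_ge0.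
have iQ2 : mu.-integrable setT (EFin \o (fun p => cmod Q.[toC p] ^+ 2)).
  have h : cintegrable mu (fun p => conjc Q.[toC p] * Q.[toC p]).
    apply: (cintegrable_mul_bounded mK muK _ CQ0).
    - by apply: cmeas_conjc; exact: cmeas_poly.
    - by move=> p Kp; rewrite cmod_conjc hCQ.
    - exact: (cintegrable_poly mK muK KB).
  case: h => + _; apply: eq_integrable => // p _ /=.
  by rewrite mul_conjc.
have ir : mu.-integrable setT (EFin \o (fun p => d + C ^+ 2 / d ^+ 3 * cmod Q.[toC p] ^+ 2)).
  exact: (integrableD measurableT (finite_measure_integrable_cst mu d measurableT)
    (integrableZl measurableT (C ^+ 2 / d ^+ 3) iQ2)).
have h : (\int[mu]_(p in setT) cmod (phi p) <= e +
    C ^+ 2 / d ^+ 3 * \int[mu]_(p in setT) (cmod Q.[toC p] ^+ 2))%R.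
  apply: (@le_trans _ _ (\int[mu]_(p in setT) (d + C ^+ 2 / d ^+ 3 * cmod Q.[toC p] ^+ 2))%R).
    apply: le_Rintegral_supported => //; first exact: cintegrable_cmod.
    move=> p Kp; have := hC p Kp; have := cmod_ge0 (phi p).
    move: (cmod (phi p)) (cmod Q.[toC p]) => t q t0 tq.
    (* If [t >= d], then [t d^3 <= t^4 <= C^2 q^2], the last step being the square of the hypothesis
       [t^2 <= C q]. *)
    have [td|/ltW dt] := leP t d.
      apply: (le_trans td); rewrite lerDl mulr_ge0 ?sqr_ge0// divr_ge0 ?sqr_ge0//.
      by rewrite exprn_ge0// ltW.
    apply: (@le_trans _ _ (C ^+ 2 / d ^+ 3 * q ^+ 2)); last by rewrite lerDr ltW.
    rewrite mulrAC ler_pdivlMr ?exprn_gt0// -exprMn.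
    apply: (@le_trans _ _ ((t ^+ 2) ^+ 2)).
      have -> : (t ^+ 2) ^+ 2 = t * t ^+ 3 by ring.
      by rewrite ler_wpM2l// lerXn2r// nnegrE ltW.
    by rewrite lerXn2r// nnegrE ?sqr_ge0// (le_trans _ tq)// sqr_ge0.
  rewrite RintegralD//.
  - rewrite Rintegral_cst// RintegralZl// lerD2r -/(mass mu) mass_mu.
    rewrite /d -[leRHS](divfK (_ : a0 + 1 != 0)); last by rewrite gt_eqF// ltr_wpDl.
    by rewrite ler_wpM2l ?lerDl// divr_ge0 ?(ltW e0)// addr_ge0.
  - exact: (finite_measure_integrable_cst mu d measurableT).
  - exact: (integrableZl measurableT (C ^+ 2 / d ^+ 3) iQ2).
apply: (@le_trans _ _ (e + C ^+ 2 / d ^+ 3 *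
    (\int[mu]_(p in setT) (cmod Q.[toC p] ^+ 2))%R)%:E).
  by rewrite lee_fin (le_trans (cmod_cint_le iphi)).
rewrite EFinD leeD2l// EFinM [X in (_ <= X * _)%E]EFinM -muleA lee_wpmul2l ?hS//.
by rewrite lee_fin divr_ge0 ?sqr_ge0// exprn_ge0// ltW.
Qed.

End denominator_bound.

(** * Poles and residues of a rational function *)

Section poles_residues.
Context {R : realType}.
Local Notation C := (R[i]).
Implicit Types (p Q N : {poly C}) (f g : C -> C) (c l : C).

Lemma cvg_punctured_id (z0 : C) : z @[z --> (z0 : C^o)^'] --> (z0 : C^o).
Proof. exact: cvg_within. Qed.

Lemma cvg_punctured_congr f g (z0 : C) (a : C) :
  (\forall z \near (z0 : C^o)^', f z = g z) ->
  g z @[z --> (z0 : C^o)^'] --> (a : C^o) ->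
  f z @[z --> (z0 : C^o)^'] --> (a : C^o).
Proof.
move=> fg; apply: cvg_trans; apply: near_eq_cvg.
by apply: filterS fg => z ->.
Qed.

Lemma cvg_puncturedD f g (z0 a b : C) :
  f z @[z --> (z0 : C^o)^'] --> (a : C^o) ->
  g z @[z --> (z0 : C^o)^'] --> (b : C^o) ->
  f z + g z @[z --> (z0 : C^o)^'] --> (a + b : C^o).
Proof. exact: (@cvgD C C^o). Qed.

Lemma cvg_puncturedM f g (z0 a b : C) :
  f z @[z --> (z0 : C^o)^'] --> (a : C^o) ->
  g z @[z --> (z0 : C^o)^'] --> (b : C^o) ->
  f z * g z @[z --> (z0 : C^o)^'] --> (a * b : C^o).
Proof. exact: (@cvgM C). Qed.

Lemma cvg_puncturedV f (z0 a : C) : a != 0 ->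
  f z @[z --> (z0 : C^o)^'] --> (a : C^o) ->
  (f z)^-1 @[z --> (z0 : C^o)^'] --> (a^-1 : C^o).
Proof. exact: (@cvgV C). Qed.

Lemma cvg_punctured_cst (c z0 : C) : c @[z --> (z0 : C^o)^'] --> (c : C^o).
Proof. exact: (@cvg_cst C^o). Qed.

Lemma cvg_horner_punctured p (z0 : C) :
  p.[z] @[z --> (z0 : C^o)^'] --> (p.[z0] : C^o).
Proof.
elim/poly_ind: p => [|p c IH].
  apply: (@cvg_punctured_congr _ (fun=> 0)); last first.
    by rewrite horner0; exact: cvg_punctured_cst.
  by apply: nearW => z; rewrite horner0.
apply: (@cvg_punctured_congr _ (fun z => p.[z] * z + c)).
  by apply: nearW => z; rewrite hornerMXaddC.
rewrite hornerMXaddC; apply: cvg_puncturedD; last exact: cvg_punctured_cst.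
exact: (cvg_puncturedM IH (@cvg_punctured_id z0)).
Qed.

Lemma cvg_XsubC_exp (z0 : C) n :
  (z - z0) ^+ n @[z --> (z0 : C^o)^'] --> ((('X - z0%:P) ^+ n).[z0] : C^o).
Proof.
apply: (@cvg_punctured_congr _ (horner (('X - z0%:P) ^+ n))).
  by apply: nearW => z; rewrite horner_exp hornerXsubC.
exact: cvg_horner_punctured.
Qed.

Lemma cvg_punctured_unique f (z0 : C) (a b : C) :
  f z @[z --> (z0 : C^o)^'] --> (a : C^o) ->
  f z @[z --> (z0 : C^o)^'] --> (b : C^o) -> a = b.
Proof.
move=> ha hb; have h : hausdorff_space C^o by exact: norm_hausdorff.
exact: (@cvg_unique C^o h _ _ a b ha hb).
Qed.

Lemma near_punctured_neq (z0 : C) : \forall z \near (z0 : C^o)^', z != z0.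
Proof. exact: nbhs_dnbhs_neq. Qed.

Lemma near_horner_neq0_of p (z0 : C) : p.[z0] != 0 ->
  \forall z \near (z0 : C^o)^', p.[z] != 0.
Proof.
move=> pz0.
exact: (@cvgr_neq0 C C^o _ _ _ (horner p) p.[z0] (@cvg_horner_punctured p z0) pz0).
Qed.

Lemma near_horner_neq0 Q (z0 : C) : Q != 0 ->
  \forall z \near (z0 : C^o)^', Q.[z] != 0.
Proof.
move=> Q0; have [m [q + QE]] := multiplicity_XsubC Q z0.
rewrite Q0 /= => qz0.
apply: filterS2 (near_horner_neq0_of qz0) (near_punctured_neq z0) => z qz zz.
by rewrite QE hornerM horner_exp hornerXsubC mulf_neq0// expf_neq0// subr_eq0.
Qed.

(** Multiplying by the highest power of [z - z0] gives a function that tends both to the top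
    coefficient and to [0 * l]; that coefficient is 0, and the rest follows by induction. This is
    the uniqueness of residues. *)
Lemma sum_principal_part (n : nat) (b : nat -> C) (z0 : C) l :
  \sum_(j < n) b j / (z - z0) ^+ j.+1 @[z --> (z0 : C^o)^'] --> (l : C^o) ->
  forall j, (j < n)%N -> b j = 0.
Proof.
elim: n => // n IH h j jn.
suff bn : b n = 0.
  move: jn; rewrite ltnS leq_eqVlt => /predU1P[->//|]; apply: IH.
  apply: cvg_trans h; apply: near_eq_cvg; apply: nearW => z.
  by rewrite big_ord_recr /= bn mul0r addr0.
pose G := \sum_(j < n.+1) (b j)%:P * ('X - z0%:P) ^+ (n - j).
have Gz0 : G.[z0] = b n.
  rewrite horner_sum big_ord_recr /= subnn expr0 mulr1 hornerC big1 ?add0r// => i _.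
  by rewrite hornerM horner_exp hornerXsubC subrr expr0n subn_eq0 leqNgt ltn_ord mulr0.
rewrite -Gz0.
apply: (@cvg_punctured_unique (horner G) z0 _ _ (@cvg_horner_punctured G z0)).
apply: (@cvg_punctured_congr _ (fun z => (z - z0) ^+ n.+1 *
    \sum_(j < n.+1) b j / (z - z0) ^+ j.+1)).
  apply: filterS (near_punctured_neq z0) => z zz.
  rewrite horner_sum mulr_sumr; apply: eq_bigr => i _.
  rewrite hornerM hornerC horner_exp hornerXsubC.
  have u0 : z - z0 != 0 by rewrite subr_eq0.
  have -> : (z - z0) ^+ n.+1 = (z - z0) ^+ (n - i) * (z - z0) ^+ i.+1.
    by rewrite -exprD addnS subnK// -ltnS.
  have := expf_neq0 i.+1 u0; move: (_ ^+ i.+1) (_ ^+ (n - i)) => v w v0.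
  by field.
have := cvg_puncturedM (@cvg_XsubC_exp z0 n.+1) h.
rewrite horner_exp hornerXsubC subrr expr0n mul0r => hG.
exact: hG.
Qed.

Section simple_pole.
Variables (Q Q' N : {poly C}) (z0 : C).
Hypotheses (QE : Q = ('X - z0%:P) * Q') (Q'z0 : Q'.[z0] != 0).

Let near_f : \forall z \near (z0 : C^o)^',
  (z - z0) * ratfun N Q z = N.[z] / Q'.[z].
Proof.
apply: filterS (near_punctured_neq z0) => z zz.
rewrite /ratfun QE hornerM hornerXsubC invfM mulrCA mulVKf//.
by rewrite subr_eq0.
Qed.

Let cvg_f : N.[z] / Q'.[z] @[z --> (z0 : C^o)^'] --> (N.[z0] / Q'.[z0] : C^o).
Proof.
apply: cvg_puncturedM; first exact: cvg_horner_punctured.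
by apply: cvg_puncturedV => //; exact: cvg_horner_punctured.
Qed.

Lemma simple_pole_of_order : N.[z0] != 0 -> pole_of_order (ratfun N Q) z0 1.
Proof.
move=> Nz0; split => //; exists (N.[z0] / Q'.[z0]).
split; first by rewrite mulf_neq0// invr_eq0.
exact: cvg_punctured_congr near_f cvg_f.
Qed.

Let c := N.[z0] / Q'.[z0].

(** [N - c Q'] vanishes at [z0]; cancelling [X - z0] from it leaves a quotient with denominator
    [Q'], continuous at [z0]. *)
Let regular_part : exists l : C,
  ratfun N Q z - c / (z - z0) @[z --> (z0 : C^o)^'] --> (l : C^o).
Proof.
have : root (N - c%:P * Q') z0.
  by rewrite rootE !hornerE divfK// subrr.
move=> /factor_theorem[M ME]; exists (M.[z0] / Q'.[z0]).
apply: (@cvg_punctured_congr _ (fun z => M.[z] / Q'.[z])); last first.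
  apply: cvg_puncturedM; first exact: cvg_horner_punctured.
  by apply: (cvg_puncturedV Q'z0); exact: cvg_horner_punctured.
apply: filterS2 (near_horner_neq0_of Q'z0) (near_punctured_neq z0) => z qz zz.
have := congr1 (horner^~ z) ME; rewrite !hornerE => h.
have u0 : z - z0 != 0 by rewrite subr_eq0.
rewrite /ratfun QE hornerM hornerXsubC.
have -> : N.[z] = M.[z] * (z - z0) + c * Q'.[z] by rewrite -h subrK.
by field; rewrite qz u0.
Qed.

Lemma is_residue_simple : is_residue (ratfun N Q) z0 c.
Proof.
have [l hl] := regular_part; exists 0, (fun=> c); split => //; exists l.
by under eq_fun do rewrite big_ord1 expr1.
Qed.

Lemma residue_simple : residue (ratfun N Q) z0 = c.
Proof.
apply: (@get_unique C^o); first exact: is_residue_simple.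
move=> d [n [b [<- [l' hl']]]]; have [l hl] := regular_part.
(* The coefficients of the difference of the two principal parts. That difference has the limit
   [l - l'], so [b' 0], the difference of the two residues, is 0. *)
pose b' (j : nat) := if j == 0 then b ord0 - c else b (inord j).
have /(_ 0)/(_ (ltn0Sn n)) : forall j, (j < n.+1)%N -> b' j = 0.
  apply: (@sum_principal_part _ _ z0 (l - l')).
  apply: (@cvg_punctured_congr _ (fun z => (ratfun N Q z - c / (z - z0)) -
    (ratfun N Q z - \sum_(j < n.+1) b j / (z - z0) ^+ j.+1)));
  last exact: (@cvgB C C^o _ _ _ _ _ _ _ hl hl').
  apply: nearW => z; rewrite !big_ord_recl /= expr1.
  have -> : \sum_(i < n) b' (bump 0 i) / (z - z0) ^+ (bump 0 i).+1 =
      \sum_(i < n) b (lift ord0 i) / (z - z0) ^+ (bump 0 i).+1.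
    apply: eq_bigr => i _; congr (b _ / _).
    by apply: val_inj; rewrite /= inordK// ltnS.
  by rewrite /b' /=; ring.
by rewrite /b' eqxx => /eqP; rewrite subr_eq0 => /eqP.
Qed.

End simple_pole.

Section rational.
Variables Q N : {poly C}.
Hypotheses (Q_neq0 : Q != 0) (coprime_QN : coprimep Q N).

Lemma root_poles (z0 : C) : root Q z0 -> poles (ratfun N Q) z0.
Proof.
move=> Qz0; have [m [q + QE]] := multiplicity_XsubC Q z0.
rewrite Q_neq0 /= => qz0; exists m; split.
  by case: m QE => // QE; move: qz0; rewrite -[q]mulr1 -[1](expr0 ('X - z0%:P)) -QE Qz0.
exists (N.[z0] / q.[z0]); split.
  rewrite mulf_neq0 ?invr_eq0//; exact: coprimep_root coprime_QN Qz0.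
apply: (@cvg_punctured_congr _ (fun z => N.[z] / q.[z])).
  apply: filterS (near_punctured_neq z0) => z zz.
  have u0 : z - z0 != 0 by rewrite subr_eq0.
  rewrite /ratfun QE hornerM horner_exp hornerXsubC invfM.
  by rewrite [q.[z]^-1 * _]mulrC mulrCA mulVKf ?expf_neq0.
apply: cvg_puncturedM; first exact: cvg_horner_punctured.
by apply: cvg_puncturedV; [exact: qz0|exact: cvg_horner_punctured].
Qed.

Lemma poles_root (z0 : C) : poles (ratfun N Q) z0 -> root Q z0.
Proof.
move=> [m [m0 [c [c0 hc]]]]; apply/negP => /negP Qz0.
move/eqP: c0; apply.
apply: (cvg_punctured_unique hc).
have -> : 0 = (('X - z0%:P) ^+ m).[z0] * (N.[z0] / Q.[z0]).
  by rewrite horner_exp hornerXsubC subrr expr0n gtn_eqF// mul0r.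
apply: cvg_puncturedM; first exact: cvg_XsubC_exp.
apply: cvg_puncturedM; first exact: cvg_horner_punctured.
by apply: cvg_puncturedV; [exact: Qz0|exact: cvg_horner_punctured].
Qed.

(** Near [z0], [N = Q' (z - z0) f]; were [Q'(z0) = 0], the right side would tend to 0 and [N] would
    share the root [z0] with [Q]. *)
Lemma pole_order1_simple (z0 : C) Q' : pole_of_order (ratfun N Q) z0 1 ->
  Q = ('X - z0%:P) * Q' -> Q'.[z0] != 0.
Proof.
move=> [_ [c [c0 hc]]] QE; apply/negP => /eqP Q'z0.
have Qz0 : root Q z0 by rewrite rootE QE hornerM hornerXsubC subrr mul0r.
have /negP := coprimep_root coprime_QN Qz0; apply; apply/eqP.
apply: (@cvg_punctured_unique (horner N) z0); first exact: cvg_horner_punctured.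
have -> : 0 = Q'.[z0] * c by rewrite Q'z0 mul0r.
apply: (@cvg_punctured_congr _ (fun z => Q'.[z] * ((z - z0) ^+ 1 * ratfun N Q z))).
  apply: filterS (near_horner_neq0 z0 Q_neq0) => z qz.
  rewrite mulrA expr1 [Q'.[z] * _]mulrC -hornerXsubC -hornerM -QE /ratfun mulrC.
  by rewrite divfK.
by apply: cvg_puncturedM; [exact: cvg_horner_punctured|exact: hc].
Qed.

End rational.

End poles_residues.

(** * Consequences of a zero infimum *)

Section necessity.
Context {R : realType}.
Variables (K : set (R * R)) (Q N : {poly R[i]}).
Hypotheses (cK : compact K) (xK : convex_set K) (Q_neq0 : Q != 0).
Let f := ratfun N Q.
Let mK : measurable K := compact_measurable2 cK.

(** Both numbers are the limit of [z f(z)] at infinity. A common mass is what makes [small_on_zeros]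
    uniform over all representing measures. *)
Lemma mass_leading_coef (a0 M r : R) mu :
  (forall z : R[i], r < cmod z -> cmod (f z - (a0%:C)%C / z) <= M / cmod z ^+ 2) ->
  representing_measures f K mu -> mass mu = a0.
Proof.
move=> hf [muK germ]; have [B _ KB] := compact_cmod_bounded cK.
suff : ((mass mu - a0)%:C)%C = 0 :> R[i].
  by move=> /eqP; rewrite eq_complex /= eqxx andbT subr_eq0 => /eqP.
apply: vanishes_at_infinity_cst => e e0.
have e2 : 0 < e / 2 by rewrite divr_gt0.
have [s hs] := transform_vanishes mK muK KB (1 * 'X) e2.
have [t ht] := germ.
pose r' := Num.max (Num.max (Num.max r s) (Num.max t B)) (Num.max 0 (M / (e / 2))).
exists r' => z; rewrite !gt_max.
move=> /andP[/andP[/andP[rz sz] /andP[tz Bz]] /andP[z0 Mz]].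
have hz := regular_infinity mK muK KB Bz.
have := hs z sz; rewrite (transformX mK muK KB _ hz) transform1 ht// moment1.
have := hf z rz.
have zn0 : z != 0 by rewrite -cmod_gt0.
rewrite /f; move: (ratfun N Q z) => w hw hT.
have h1 : cmod (z * w - (a0%:C)%C) <= e / 2.
  have -> : z * w - (a0%:C)%C = z * (w - (a0%:C)%C / z) by field.
  rewrite cmodM (le_trans (ler_wpM2l (cmod_ge0 z) hw))//.
  rewrite expr2 invfM mulrCA mulVKf ?cmod_eq0//.
  rewrite ler_pdivrMr//; move: Mz; rewrite ltr_pdivrMr// => /ltW.
  by rewrite [X in _ <= X -> _]mulrC.
have -> : ((mass mu - a0)%:C)%C = (z * w - (a0%:C)%C) - (z * w - ((mass mu)%:C)%C).
  by rewrite rmorphB; ring.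
by rewrite (le_trans (cmodB_le _ _))// [leRHS]splitr lerD.
Qed.

Hypothesis coprime_QN : coprimep Q N.
Hypothesis f_pos : positive_germ f.
Hypothesis min0 : min_deviation Q N f K = 0%E.

Lemma small_deviation (e : R) : 0 < e ->
  exists2 mu, representing_measures f K mu & (deviation Q N K mu < e%:E)%E.
Proof.
move=> e0; have : (min_deviation Q N f K < e%:E)%E by rewrite min0 lte_fin.
by move=> /ereal_inf_lt[_ [mu rmu <-] hmu]; exists mu.
Qed.

(* In the applications the integral does not depend on mu, so it vanishes. *)
Lemma constant_integral (phi : R * R -> R[i]) (C e : R) : cmeas phi -> 0 <= C ->
  (forall p, K p -> cmod (phi p) ^+ 2 <= C * cmod Q.[toC p]) -> 0 < e ->
  exists2 mu, representing_measures f K mu & cmod (cint mu phi) <= e.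
Proof.
move=> mphi C0 hC e0; have [a0 [a00 [M [r hr]]]] := f_pos.
have e2 : 0 < e / 2 by rewrite divr_gt0.
have [S S0 hS] := small_on_zeros N cK xK Q_neq0 mphi C0 hC (ltW a00) e2.
have S1 : 0 < S + 1 by rewrite ltr_wpDl.
(* The constant [S] is known before [mu], so the required smallness may depend on it. *)
have [mu rmu hmu] := small_deviation (divr_gt0 e2 S1).
exists mu => //; rewrite -lee_fin.
apply: (le_trans (hS mu rmu (mass_leading_coef hr rmu))).
rewrite [X in (_ <= X%:E)%E]splitr EFinD leeD2l//.
have D0 := deviation_ge0 K Q N mu.
apply: (@le_trans _ _ ((S + 1)%:E * deviation Q N K mu)%E).
  by rewrite lee_wpmul2r// lee_fin lerDl.
by rewrite muleC -lee_pdivlMr// ltW// -EFinM.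
Qed.

Lemma numerator_moment mu Q' (z : R[i]) : representing_measures f K mu ->
  Q = ('X - z%:P) * Q' -> N.[z] = cint mu (fun p => Q'.[toC p]).
Proof.
move=> [muK germ] QE; have [B _ KB] := compact_cmod_bounded cK.
exact: (numerator_at_root mK muK KB Q_neq0 germ QE).
Qed.

Lemma root_simple (z : R[i]) Q' : Q = ('X - z%:P) * Q' -> Q'.[z] != 0.
Proof.
move=> QE; apply/negP => Q'z.
have /factor_theorem[Q1 Q'E] : root Q' z by [].
have Nz : N.[z] != 0.
  by apply: coprimep_root coprime_QN _; rewrite rootE QE hornerM hornerXsubC subrr mul0r.
have [B _ KB] := compact_cmod_bounded cK; have [C C0 hC] := poly_bounded KB Q1.
have : N.[z] = 0; last by move/eqP; rewrite (negbTE Nz).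
apply/eqP; rewrite -cmod_eq0 eq_le cmod_ge0 andbT.
apply/ler_addgt0Pl => e e0; rewrite addr0.
have hphi p : K p -> cmod Q'.[toC p] ^+ 2 <= C * cmod Q.[toC p].
  move=> Kp; rewrite expr2 {1}Q'E QE !hornerM !cmodM.
  rewrite -mulrA ler_pM ?mulr_ge0 ?cmod_ge0 ?hC//.
have [mu rmu] := constant_integral (cmeas_poly Q') C0 hphi e0.
by rewrite (numerator_moment rmu QE).
Qed.

Lemma residue_gt0 (z : R[i]) Q' : Q = ('X - z%:P) * Q' -> 0 < N.[z] / Q'.[z].
Proof.
move=> QE; have Q'z := root_simple QE.
have Nz : N.[z] != 0.
  by apply: coprimep_root coprime_QN _; rewrite rootE QE hornerM hornerXsubC subrr mul0r.
set c := N.[z] / Q'.[z]; have c0 : c != 0 by rewrite mulf_neq0// invr_eq0.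
pose l : {poly R[i]} := Q'.[z]^-1 *: Q'.
have cl mu : representing_measures f K mu -> c = moment mu l.
  move=> rmu; have [muK _] := rmu; have [B _ KB] := compact_cmod_bounded cK.
  by rewrite /c (numerator_moment rmu QE) (momentZ mK muK KB) mulrC.
have /factor_theorem[u uE] : root (1 - l) z.
  by rewrite rootE !hornerE mulVf// subrr.
pose phi (p : R * R) := l.[toC p] - conjc l.[toC p] * l.[toC p].
have [B B0 KB] := compact_cmod_bounded cK.
have [C1 C10 h1] := poly_bounded KB u.
have [C2 C20 h2] := poly_bounded KB Q.
have mphi : cmeas phi.
  apply: cmeasD; first exact: cmeas_poly.
  apply: cmeasN; apply: cmeasM; last exact: cmeas_poly.
  by apply: cmeas_conjc; exact: cmeas_poly.
pose k := cmod Q'.[z]^-1 * C1.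
have k0 : 0 <= k by rewrite mulr_ge0 ?cmod_ge0.
have phiQ p : K p -> cmod (phi p) <= k * cmod Q.[toC p].
  (* The factor [l] carries [Q'], and [1 - l] vanishes at [z], thus carries [X - z]; together they
     supply a factor [|Q|]. *)
  move=> Kp; have -> : phi p = l.[toC p] * conjc (1 - l).[toC p].
    rewrite /phi hornerD hornerN hornerC.
    rewrite (_ : conjc (1 - _) = 1 - conjc l.[toC p]); first by ring.
    by rewrite rmorphB rmorph1.
  rewrite uE cmodM cmod_conjc hornerM QE hornerM hornerZ !cmodM /k.
  have -> : cmod Q'.[z]^-1 * C1 * (cmod ('X - z%:P).[toC p] * cmod Q'.[toC p]) =
      cmod Q'.[z]^-1 * cmod Q'.[toC p] * cmod ('X - z%:P).[toC p] * C1 by ring.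
  by rewrite [cmod u.[_] * _]mulrC mulrA ler_wpM2l ?h1// !mulr_ge0// cmod_ge0.
have hphi p : K p -> cmod (phi p) ^+ 2 <= k ^+ 2 * C2 * cmod Q.[toC p].
  move=> Kp; apply: (@le_trans _ _ ((k * cmod Q.[toC p]) ^+ 2)).
    by rewrite lerXn2r ?nnegrE ?mulr_ge0 ?cmod_ge0 ?phiQ.
  rewrite exprMn -mulrA ler_wpM2l ?sqr_ge0// expr2 ler_wpM2r ?cmod_ge0//.
  exact: h2.
(* [c = int l dmu] for every [mu], and [int phi dmu] is the gap between it and the nonnegative
   number [int |l|^2 dmu]. *)
have key (e : R) : 0 < e -> exists2 s : R, 0 <= s & cmod (c - (s%:C)%C) <= e.
  move=> e0; have kC : 0 <= k ^+ 2 * C2 by rewrite mulr_ge0 ?sqr_ge0.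
  have [mu rmu hmu] := constant_integral mphi kC hphi e0.
  have [muK _] := rmu.
  exists (\int[mu]_(p in setT) (cmod l.[toC p] ^+ 2))%R.
    by apply: Rintegral_ge0 => p _; rewrite sqr_ge0.
  move: hmu; rewrite /phi cintB.
  - have -> : (fun p : R * R => conjc l.[toC p] * l.[toC p]) =
        fun p => ((cmod l.[toC p] ^+ 2)%:C)%C.
      by apply/funext => p; rewrite mul_conjc.
    by rewrite cint_real (cl mu rmu).
  - exact: (cintegrable_poly mK muK KB).
  - have [C3 C30 h3] := poly_bounded KB l.
    apply: (cintegrable_mul_bounded mK muK _ C30 _ (cintegrable_poly mK muK KB l)).
      by apply: cmeas_conjc; exact: cmeas_poly.
    by move=> p Kp; rewrite cmod_conjc h3.
have cI : complex.Im c = 0.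
  apply/eqP; rewrite -normr_eq0 eq_le normr_ge0 andbT.
  apply/ler_addgt0Pl => e /key[s s0 hs]; rewrite addr0.
  apply: le_trans hs; apply: le_trans (normr_Im_le _).
  by case: (c) => a b /=; rewrite oppr0 addr0.
have cR : 0 <= complex.Re c.
  apply/ler_addgt0Pr => e /key[s s0 hs].
  have : `|complex.Re c - s| <= e.
    apply: le_trans hs; apply: le_trans (normr_Re_le _).
    by case: (c) => a b /=.
  by rewrite ler_distl => /andP[+ _]; lra.
rewrite lt_def c0 /=; move: cI cR; case: (c) => a b /= -> a0.
by rewrite lecE /= eqxx.
Qed.

End necessity.

(** * Finite sums of point masses *)

Section point_masses.
Context {R : realType}.
Variables (s : seq R[i]) (w : R[i] -> {nonneg R}).

Definition point_masses : set (R * R)%type -> \bar R :=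
  msum (fun i => mscale (w s`_i) (dirac (ofC s`_i))) (size s).

HB.instance Definition _ := Measure.on point_masses.

Lemma point_massesE A :
  point_masses A = (\sum_(z <- s) (w z)%:num%:E * \d_(ofC z) A)%E.
Proof. by rewrite (big_nth 0) big_mkord. Qed.

Lemma point_masses_fin : fin_num_fun point_masses.
Proof.
move=> A mA; rewrite point_massesE; elim/big_ind: _ => // x y hx hy.
by rewrite fin_numD hx.
Qed.

HB.instance Definition _ :=
  Measure_isFinite.Build _ _ _ point_masses point_masses_fin.

Lemma ge0_integral_point_masses (f : R * R -> R) : measurable_fun setT f ->
  (forall p, 0 <= f p) ->
  (\int[point_masses]_(p in setT) (f p)%:E =
   (\sum_(z <- s) (w z)%:num * f (ofC z))%R%:E)%E.
Proof.
move=> mf f0; have mfe : measurable_fun setT (EFin \o f) by exact/measurable_EFinP.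
rewrite ge0_integral_measure_sum//; last by move=> p _; rewrite lee_fin.
rewrite (big_nth 0) big_mkord -sumEFin; apply: eq_bigr => i _.
rewrite ge0_integral_mscale//; last by move=> p _; rewrite lee_fin.
by rewrite integral_dirac// diracT mul1e.
Qed.

Lemma Rintegral_point_masses (f : R * R -> R) : measurable_fun setT f ->
  (\int[point_masses]_(p in setT) f p = \sum_(z <- s) (w z)%:num * f (ofC z))%R.
Proof.
move=> mf; rewrite /Rintegral integralE.
have -> : ((fun p => (f p)%:E)^\+ = fun p => (Num.max (f p) 0)%:E)%E.
  by apply/funext => p; rewrite funeposE EFin_max.
have -> : ((fun p => (f p)%:E)^\- = fun p => (Num.max (- f p) 0)%:E)%E.
  by apply/funext => p; rewrite funenegE EFin_max.
rewrite !ge0_integral_point_masses//=.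
- rewrite -sumrB; apply: eq_bigr => z _; rewrite -mulrBr; congr (_ * _).
  have [f0|/ltW f0] := leP 0 (f (ofC z)).
    by rewrite (max_idPr _) ?subr0// oppr_le0.
  by rewrite (max_idPl _) ?sub0r ?opprK// oppr_ge0.
- by apply: measurable_maxr => //; exact: measurable_funN.
- by move=> p; rewrite le_max lexx orbT.
- by apply: measurable_maxr.
- by move=> p; rewrite le_max lexx orbT.
Qed.

Lemma cauchy_transform_point_masses z :
  cauchy_transform point_masses z =
  \sum_(x <- s) (((w x)%:num)%:C)%C * (z - x)^-1.
Proof.
have [m1 m2] : cmeas (fun p : R * R => (z - toC p)^-1).
  apply: cmeasV; apply: cmeasD; first exact: cmeas_cst.
  by apply: cmeasN; exact: cmeas_toC.
rewrite /cauchy_transform !Rintegral_point_masses//.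
elim: (s) => [|x t IH]; first by rewrite !big_nil.
rewrite !big_cons -IH ofCK; case: ((z - x)^-1) => a b.
by apply/eqP; rewrite eq_complex /= !mul0r subr0 addr0 !eqxx.
Qed.

End point_masses.

(** * Partial fractions with simple poles *)

Section partial_fractions.
Context {C : numClosedFieldType}.
Variables (Q N : {poly C}) (s : seq C) (c : C).
Hypotheses (c0 : c != 0) (QE : Q = c *: \prod_(z <- s) ('X - z%:P)).

(** For [z] in [s] this is [Q / (X - z)], whose value at [z] is the derivative of [Q] there. [rem]
    drops one occurrence only, so a repeated root remains a root of its cofactor. *)
Definition cofactor_at z : {poly C} := c *: \prod_(x <- rem z s) ('X - x%:P).

Lemma cofactor_atE z : z \in s -> Q = ('X - z%:P) * cofactor_at z.
Proof. by move=> zs; rewrite QE (big_rem z)//= scalerAr. Qed.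

Lemma root_mem z : root Q z = (z \in s).
Proof. by rewrite QE rootZ// root_prod_XsubC. Qed.

Lemma uniq_simple_roots : (forall z Q', Q = ('X - z%:P) * Q' -> Q'.[z] != 0) ->
  uniq s.
Proof.
move=> h; apply: count_mem_uniq => z.
have [zs|zs] := boolP (z \in s); last by apply/count_memPn.
have := h z _ (cofactor_atE zs).
rewrite /cofactor_at hornerZ mulf_eq0 (negbTE c0)/= -[_ == 0]/(root _ _).
rewrite root_prod_XsubC => /count_memPn; rewrite count_rem zs /= eqxx.
have : (0 < count_mem z s)%N by rewrite -has_count has_pred1.
by case: (count_mem z s) => // n _; rewrite subn1 /= => ->.
Qed.

Hypothesis us : uniq s.

Lemma cofactor_at_root z x : x \in s -> x != z -> (cofactor_at z).[x] = 0.
Proof.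
move=> xs xz; apply/eqP; rewrite hornerZ mulf_eq0 -[X in _ || X]/(root _ _).
by rewrite root_prod_XsubC mem_rem_uniq// !inE xz xs orbT.
Qed.

Lemma cofactor_at_neq0 z : z \in s -> (cofactor_at z).[z] != 0.
Proof.
move=> zs; rewrite hornerZ mulf_neq0// -[_ == 0]/(root _ _).
by rewrite root_prod_XsubC mem_rem_uniqF.
Qed.

(** Lagrange interpolation: both sides agree at the distinct points of [s], and their size is at
    most the number of those points. *)
Lemma partial_fractions : (size N <= (size Q).-1)%N ->
  N = \sum_(z <- s) (N.[z] / (cofactor_at z).[z]) *: cofactor_at z.
Proof.
have sQ : (size Q).-1 = size s by rewrite QE size_scale// size_prod_XsubC.
rewrite sQ => sN; apply/eqP; rewrite -subr_eq0; apply/eqP.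
apply: (@roots_geq_poly_eq0 _ _ s) => //.
  apply/allP => x xs; rewrite rootE hornerD hornerN horner_sum.
  rewrite (big_rem x)//= hornerZ divfK ?cofactor_at_neq0// big1_seq ?addr0 ?subrr//.
  move=> z; rewrite mem_rem_uniq// !inE => /andP[_ /andP[zx zs]].
  by rewrite hornerZ (@cofactor_at_root z x) ?mulr0// eq_sym.
rewrite (leq_trans (size_polyD _ _))// geq_max sN size_polyN.
rewrite (leq_trans (size_sum _ _ _))//; apply/bigmax_leqP_seq => z zs _.
rewrite (leq_trans (size_scale_leq _ _))// (leq_trans (size_scale_leq _ _))//.
by rewrite size_prod_XsubC size_rem// prednK//; case: (s) zs.
Qed.

Lemma ratfun_partial_fractions z : (size N <= (size Q).-1)%N -> Q.[z] != 0 ->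
  N.[z] / Q.[z] = \sum_(x <- s) (N.[x] / (cofactor_at x).[x]) * (z - x)^-1.
Proof.
move=> sN Qz; rewrite {1}(partial_fractions sN) horner_sum mulr_suml.
apply: eq_big_seq => x xs; rewrite hornerZ -mulrA; congr (_ * _).
have := Qz; rewrite (cofactor_atE xs) hornerM hornerXsubC mulf_eq0 negb_or.
by move=> /andP[zx cz]; rewrite invfM mulrCA mulfV ?mulr1.
Qed.

End partial_fractions.

Lemma complex_gt0 (R : realType) (z : R[i]) : 0 < z -> ((`|complex.Re z|)%:C)%C = z.
Proof.
case: z => a b; rewrite ltcE /= => /andP[/eqP -> a0].
by rewrite ger0_norm// ltW.
Qed.

(** * The atomic measure of the residues *)

Section atomic_representation.
Context {R : realType}.
Variables (K : set (R * R)) (Q N : {poly R[i]}).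
Hypotheses (cK : compact K) (xK : convex_set K) (Q_neq0 : Q != 0).
Let f := ratfun N Q.
Let mK : measurable K := compact_measurable2 cK.

Variables (s : seq R[i]).
Hypotheses (us : uniq s) (QE : Q = lead_coef Q *: \prod_(z <- s) ('X - z%:P)).
Let Q' := cofactor_at s (lead_coef Q).
Let lQ : lead_coef Q != 0. Proof. by rewrite lead_coef_eq0. Qed.
Hypothesis pos : forall z, z \in s -> 0 < N.[z] / (Q' z).[z].

(* The absolute value only makes the weight nonnegative by construction. *)
Definition weight (z : R[i]) : {nonneg R} :=
  (`|complex.Re (N.[z] / (Q' z).[z])|)%:nng.

Lemma weightE z : z \in s -> (((weight z)%:num)%:C)%C = N.[z] / (Q' z).[z].
Proof. by move=> zs; rewrite complex_gt0//; exact: pos. Qed.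

Let mu0 : {finite_measure set (R * R)%type -> \bar R} := point_masses s weight.

Lemma area_roots : {ae @area R, forall p, toC p \notin s}.
Proof.
elim: (s) => [|z t IH]; first by apply: nearW => p.
have hz : {ae @area R, forall p, p != ofC z}.
  exists [set ofC z]; split; [exact: measurable_point|exact: area_point|].
  by move=> p /= /negP; rewrite negbK => /eqP.
apply: filterS2 IH hz => p pt pz; rewrite inE negb_or pt andbT.
by apply: contra pz => /eqP <-; rewrite toCK.
Qed.

Section representing.
Hypothesis sN : (size N <= (size Q).-1)%N.

Lemma cauchy_transform_atomic z : Q.[z] != 0 ->
  cauchy_transform mu0 z = ratfun N Q z.
Proof.
move=> Qz; rewrite cauchy_transform_point_masses /ratfun.
rewrite (ratfun_partial_fractions lQ QE us sN Qz).
by apply: eq_big_seq => x xs; rewrite weightE.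
Qed.

Lemma representing_atomic : (forall z, z \in s -> K (ofC z)) ->
  representing_measures f K mu0.
Proof.
move=> sK; split.
  rewrite [LHS]point_massesE big1_seq// => z /andP[_ zs].
  by rewrite diracE memNset ?mule0//= => /(_ (sK z zs)).
have [r hr] := horner_neq0_far Q_neq0; exists r => z /hr.
exact: cauchy_transform_atomic.
Qed.

(** The integrand vanishes off the roots of [Q], where the transform equals [N / Q], and finitely
    many points have area 0. *)
Lemma deviation_atomic : deviation Q N K mu0 = 0%E.
Proof.
rewrite /deviation -[RHS](integral0 (@area R) K); apply: ae_eq_integral => //.
- apply/measurable_EFinP; apply: measurable_funTS.
  exact: measurable_deviation_integrand.
- apply: filterS area_roots => p ps _; rewrite cauchy_transform_atomic.
    by rewrite /ratfun mulrC divfK ?subrr ?cmod0// -[_ == 0]/(root _ _) (root_mem lQ QE).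
  by rewrite -[_ == 0]/(root _ _) (root_mem lQ QE).
Qed.

End representing.

Lemma atomic_of_deviation0 (nu : {finite_measure set (R * R)%type -> \bar R}) :
  representing_measures f K nu -> deviation Q N K nu = 0%E ->
  {ae nu, forall p, toC p \in s}.
Proof.
move=> rnu dnu; have [S S0 hS] := denominator_sqr_bound N cK xK Q_neq0.
have := hS nu rnu; rewrite dnu mule0 lee_fin => h.
have [nuK germ] := rnu; have [B _ KB] := compact_cmod_bounded cK.
have [C C0 hC] := poly_bounded KB Q.
have mq : measurable_fun setT (fun p : R * R => cmod Q.[toC p] ^+ 2).
  by apply: measurable_funX; apply: measurable_cmod; exact: cmeas_poly.
have iq : nu.-integrable setT (EFin \o (fun p : R * R => cmod Q.[toC p] ^+ 2)).
  have -> : (fun p : R * R => cmod Q.[toC p] ^+ 2) =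
      fun p => cmod (Q.[toC p] * Q.[toC p]).
    by apply/funext => p; rewrite cmodM expr2.
  apply: cintegrable_cmod; apply: (cintegrable_mul_bounded mK nuK _ C0 hC).
    exact: cmeas_poly.
  exact: (cintegrable_poly mK nuK KB).
have q0 : (\int[nu]_(p in setT) (cmod Q.[toC p] ^+ 2)%:E = 0)%E.
  rewrite -[LHS]fineK; last exact: integrable_fin_num iq.
  congr (_%:E); apply/eqP; rewrite eq_le h /=.
  by apply: fine_ge0; apply: integral_ge0 => p _; rewrite lee_fin sqr_ge0.
have mqe : measurable_fun setT (EFin \o (fun p : R * R => cmod Q.[toC p] ^+ 2)).
  exact/measurable_EFinP.
have abs0 : (\int[nu]_(p in setT) `|(cmod Q.[toC p] ^+ 2)%:E| = 0)%E.
  rewrite -[RHS]q0; apply: eq_integral => p _.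
  by rewrite gee0_abs// lee_fin sqr_ge0.
apply: filterS ((ae_eq_integral_abs nu measurableT mqe).1 abs0) => p /(_ I)[] /eqP.
by rewrite sqrf_eq0 cmod_eq0 -[_ == 0]/(root _ _) (root_mem lQ QE).
Qed.

(** On the roots the cofactor of [z] vanishes except at [z], so its integral [N(z)] is the atom at
    [z] times its value there. Hence the atoms are the weights. *)
Lemma atomic_unique (nu : {finite_measure set (R * R)%type -> \bar R}) :
  representing_measures f K nu -> {ae nu, forall p, toC p \in s} ->
  forall A, measurable A -> nu A = mu0 A.
Proof.
move=> [nuK germ] nus A mA; have [B _ KB] := compact_cmod_bounded cK.
pose atom z : R := fine (nu [set ofC z]).
have atomE z : (atom z)%:E = nu [set ofC z].
  by rewrite fineK// fin_num_measure//; exact: measurable_point.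
have atom_weight z : z \in s -> atom z = (weight z)%:num.
  move=> zs; suff : ((atom z)%:C)%C = (((weight z)%:num)%:C)%C by case.
  rewrite weightE//; apply: (canRL (mulfK (cofactor_at_neq0 lQ us zs))).
  rewrite (numerator_at_root mK nuK KB Q_neq0 germ (cofactor_atE QE zs)).
  have mi : measurable_fun setT (\1_[set ofC z] : R * R -> R).
    by apply: measurable_indic; exact: measurable_point.
  have ii : nu.-integrable setT (EFin \o (\1_[set ofC z] : R * R -> R)).
    by apply: integrable_indic => //; exact: measurable_point.
  have -> : ((atom z)%:C)%C * (Q' z).[z] =
      cint nu (fun p => (Q' z).[z] * ((\1_[set ofC z] p)%:C)%C).
    rewrite cintZ; last by split; [exact: ii|exact: integrable0].
    rewrite cint_real /Rintegral integral_indic// ?setIT; last exact: measurable_point.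
    by rewrite mulrC.
  apply: ae_eq_cint.
  - by apply: cmeasM; [exact: cmeas_cst|exact: cmeas_real].
  - exact: cmeas_poly.
  apply: filterS nus => p ps; rewrite indicE.
  have [->|pz] := eqVneq p (ofC z).
    by rewrite mem_set//= mulr1 ofCK.
  rewrite memNset/=; last by move=> /= /eqP; rewrite (negbTE pz).
  rewrite mulr0 (cofactor_at_root (lead_coef Q) us ps)//.
  by apply: contra pz => /eqP <-; rewrite toCK.
rewrite [RHS]point_massesE -[A]setIT -integral_indic//.
(* Summed over [s], these functions equal the indicator of [A] at every root, hence [nu]-almost
   everywhere. *)
pose g z p : \bar R := ((\1_A (ofC z) : R)%:E * (\1_[set ofC z] p : R)%:E)%E.
transitivity (\int[nu]_(p in setT) (\sum_(z <- s) g z p))%E.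
  apply: ae_eq_integral => //.
  - by apply/measurable_EFinP; exact: measurable_indic.
  - apply: emeasurable_sum => z; apply: emeasurable_funM => //.
    by apply/measurable_EFinP/measurable_indic; exact: measurable_point.
  apply: filterS nus => p ps _; rewrite (big_rem _ ps)/= big1_seq ?addr0.
    by rewrite /g toCK !indicE (mem_set (A := [set p]))// mule1.
  move=> z; rewrite mem_rem_uniq// !inE => /andP[_ /andP[zp zs]].
  rewrite /g [\1_[set _] _]indicE memNset ?mule0// => /= pz.
  by move/eqP: zp; apply; rewrite pz ofCK.
rewrite ge0_integral_sum//.
- apply: eq_big_seq => z zs; rewrite ge0_integralZl//.
  + rewrite integral_indic ?setIT//; last exact: measurable_point.
    by rewrite -atom_weight// atomE muleC diracE indicE.
  + by apply/measurable_EFinP/measurable_indic; exact: measurable_point.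
- move=> z; apply: emeasurable_funM => //.
  by apply/measurable_EFinP/measurable_indic; exact: measurable_point.
- by move=> z p _; rewrite /g mule_ge0// lee_fin.
Qed.

End atomic_representation.

Theorem theorem7p3 (R : realType) (Q N : {poly R[i]}) (f : R[i] -> R[i])
    (K : set (R * R)%type)
    (Q_neq0 : Q != 0)
    (coprime_QN : coprimep Q N)
    (fE : f = ratfun N Q)
    (f_pos : positive_germ f)
    (K_compact : compact K)
    (K_convex : convex_set K)
    (M_neq0 : representing_measures f K !=set0) :
  (min_deviation Q N f K = 0%E <->
     forall z0, poles f z0 ->
       [/\ pole_of_order f z0 1, K (ofC z0) & 0 < residue f z0])
  /\
  (min_deviation Q N f K = 0%E ->
     exists mu : {finite_measure set (R * R)%type -> \bar R},
       [/\ representing_measures f K mu,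
           deviation Q N K mu = 0%E,
           forall A, measurable A -> mu A = residue_measure f A
         & forall nu : {finite_measure set (R * R)%type -> \bar R},
             representing_measures f K nu -> deviation Q N K nu = 0%E ->
             forall A, measurable A -> nu A = mu A]).
Proof.
subst f; set f := ratfun N Q.
have mK := compact_measurable2 K_compact.
have [B _ KB] := compact_cmod_bounded K_compact.
have [mu [muK germ]] := M_neq0.
(* Properness of [N / Q], needed for partial fractions, comes from the existence of some
   representing measure. *)
have [sN _] := transform_denominator mK muK KB Q_neq0 germ.
have forward : min_deviation Q N f K = 0%E -> forall z, poles f z ->
    [/\ pole_of_order f z 1, K (ofC z) & 0 < residue f z].
  move=> min0 z /poles_root Qz.
  have [Q' QE] := factor_theorem _ _ Qz; rewrite mulrC in QE.
  have Q'z := root_simple K_compact K_convex Q_neq0 coprime_QN f_pos min0 QE.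
  have Nz : N.[z] != 0 := coprimep_root coprime_QN Qz.
  split; first exact: simple_pole_of_order QE Q'z Nz.
    exact: (root_in_support mK muK KB Q_neq0 germ K_compact K_convex coprime_QN Qz).
  rewrite /f (residue_simple N QE Q'z).
  exact: (residue_gt0 K_compact K_convex Q_neq0 coprime_QN f_pos min0 QE).
(* One construction serves both claims: the atomic measure shows that the infimum is 0, and it is
   the minimizer of the second part. *)
have backward : (forall z, poles f z ->
    [/\ pole_of_order f z 1, K (ofC z) & 0 < residue f z]) ->
    exists mu : {finite_measure set (R * R)%type -> \bar R},
       [/\ representing_measures f K mu,
           deviation Q N K mu = 0%E,
           forall A, measurable A -> mu A = residue_measure f A
         & forall nu : {finite_measure set (R * R)%type -> \bar R},
             representing_measures f K nu -> deviation Q N K nu = 0%E ->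
             forall A, measurable A -> nu A = mu A].
  move=> hp; have [s QE] := closed_field_poly_normal Q.
  have lQ : lead_coef Q != 0 by rewrite lead_coef_eq0.
  have polesE : poles f = [set` s].
    apply/seteqP; split => z /=.
      by move=> /poles_root; rewrite (root_mem lQ QE).
    by rewrite -(root_mem lQ QE); exact: root_poles.
  have us : uniq s.
    apply: (uniq_simple_roots lQ QE) => z Q' QzE.
    have /hp[pz _ _] : poles f z.
      by apply: root_poles => //; rewrite rootE QzE hornerM hornerXsubC subrr mul0r.
    exact: pole_order1_simple pz QzE.
  have resE z : z \in s ->
      residue f z = N.[z] / (cofactor_at s (lead_coef Q) z).[z].
    move=> zs; apply: residue_simple; first exact: cofactor_atE.
    exact: cofactor_at_neq0.
  have pos z : z \in s -> 0 < N.[z] / (cofactor_at s (lead_coef Q) z).[z].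
    by move=> zs; rewrite -resE//; have [] : _ := hp z; rewrite ?polesE.
  have sK z : z \in s -> K (ofC z).
    by move=> zs; have [] := hp z; rewrite ?polesE.
  exists (point_masses s (weight Q N s)); split.
  - exact: (representing_atomic Q_neq0 us QE pos sN sK).
  - exact: (deviation_atomic K_compact Q_neq0 us QE pos sN).
  - move=> A mA; rewrite [LHS]point_massesE /residue_measure polesE -fsbig_seq//.
    apply: eq_big_seq => z zs; rewrite resE//; congr (_%:E * _)%E.
    rewrite /= ger0_norm//; have := pos z zs; move: (_ / _) => [a b].
    by rewrite ltcE => /andP[_ /ltW].
  - move=> nu rnu dnu A mA; apply: (atomic_unique K_compact Q_neq0 us QE pos rnu) => //.
    exact: (atomic_of_deviation0 K_compact K_convex Q_neq0 QE rnu dnu).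
split; last by move=> /forward /backward.
split=> [/forward//|/backward[nu [rnu dnu _ _]]].
apply/eqP; rewrite eq_le; apply/andP; split.
  by apply: ereal_inf_lbound; exists nu.
by apply: le_ereal_inf_tmp => _ [m _ <-]; exact: deviation_ge0.
Qed.
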